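(* Let $\mathcal Q,\mathcal Y,Y,\mathfrak c,F,F_n,\mathfrak l$ be as in the context, and assume the following. (Existence) $\mathbb E[|\mathfrak c(Y,q)|]<\infty$ for all $q\in\mathcal Q$; there are a measurable $m_n\in\arg\min_{q\in\mathcal Q}F_n(q)$ and an $m\in\arg\min_{q\in\mathcal Q}F(q)$. (Growth) There are constants $\gamma>0$, $c_{\mathsf g}>0$ such that $F(q)-F(m)\ge c_{\mathsf g}\,\mathfrak l(m,q)^\gamma$ for all $q\in\mathcal Q$. (Weak Quadruple) There are a measurable function $\mathfrak a:\mathcal Y\times\mathcal Y\to[0,\infty)$ and a pseudo-metric $\mathfrak b:\mathcal Q\times\mathcal Q\to[0,\infty)$ such that for all $p,q\in\mathcal Q$, $y,z\in\mathcal Y$, $$\mathfrak c(y,q)-\mathfrak c(z,q)-\mathfrak c(y,p)+\mathfrak c(z,p)\le \mathfrak a(y,z)\,\mathfrak b(q,p).$$ (Moment) $\zeta\ge1$ and $\mathfrak M(\zeta)<\infty$. (Entropy) There are $\alpha,\beta>0$ with $\frac\alpha\beta<\gamma$ and $c_{\mathsf e}>0$ such that for all $\delta,r>0$ $$\sqrt{\log N(\mathrm B_\delta(m,\mathfrak l),\mathfrak b,r)}\le c_{\mathsf e}\frac{\delta^\alpha}{r^\beta}.$$ Define $\eta_{\beta,n}:=n^{-1/2}$ if $\beta<1$, $\eta_{\beta,n}:=n^{-1/2}\log(n+1)$ if $\beta=1$, and $\eta_{\beta,n}:=n^{-\frac1{2\beta}}$ if $\beta>1$. Then for all $t>0$ $$\mathbb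 P\Big(\eta_{\beta,n}^{-\frac1{\gamma-\frac\alpha\beta}}\,\mathfrak l(m,m_n)\ge t\Big)\le c\,\mathfrak M(\zeta)\,t^{-\zeta(\gamma-\frac\alpha\beta)},$$ where $c>0$ depends only on $\alpha,\beta,\gamma,c_{\mathsf e},c_{\mathsf g},\zeta$.
   Context: Setting: $\mathcal Q$ is a set (descriptor space), $(\mathcal Y,\Sigma_{\mathcal Y})$ a measurable space (data space), $Y$ a $\mathcal Y$-valued random variable, $\mathfrak c:\mathcal Y\times\mathcal Q\to\mathbb R$ (cost function) is such that $y\mapsto\mathfrak c(y,q)$ is measurable for every $q\in\mathcal Q$. $F(q):=\mathbb E[\mathfrak c(Y,q)]$. For $n\in\mathbb N$, $Y_1,\dots,Y_n$ are independent copies of $Y$ and $F_n(q):=\frac1n\sum_{i=1}^n\mathfrak c(Y_i,q)$. $\mathfrak l:\mathcal Q\times\mathcal Q\to[0,\infty)$ is a function (loss). With $Y'$ an independent copy of $Y$, $\mathfrak M(\zeta):=\mathbb E[\mathfrak a(Y',Y)^\zeta]$ if $\zeta\ge2$ and $\mathfrak M(\zeta):=\mathbb E[\mathfrak a(Y',Y)^2]^{\zeta/2}$ if $\zeta\le2$. For $d:\mathcal Q\times\mathcal Q\to[0,\infty)$, $\mathrm B_r(o,d):=\{q\in\mathcal Q: d(o,q)\le r\}$. For $A\subseteq\mathcal Q$, $N(A,\mathfrak b,r)$ is the covering number: the minimal $k\in\mathbb N$ such that there are $q_1,\dots,q_k\in\mathcal Q$ with $A\subseteq\bigcup_{j=1}^k\mathrm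 B_r(q_j,\mathfrak b)$. *)

(* Defs.v *)
From HB Require Import structures.
From mathcomp Require Import all_boot all_order all_algebra.
From mathcomp Require Import all_classical all_reals all_analysis.

Set Implicit Arguments.
Unset Strict Implicit.
Unset Printing Implicit Defensive.

Import Order.TTheory GRing.Theory Num.Theory.
Import numFieldNormedType.Exports.

Local Open Scope classical_set_scope.
Local Open Scope ring_scope.

Definition argmin (d : Order.disp_t) (T : porderType d) (Q : Type)
    (f : Q -> T) : set Q :=
  [set m | forall q, (f m <= f q)%O].

Definition pseudometric (R : realType) (Q : Type) (b : Q -> Q -> R) : Prop :=
  [/\ forall p q, 0 <= b p q,
      forall q, b q q = 0,
      forall p q, b p q = b q p
    & forall p q s, b p s <= b p q + b q s].

Definition cball (R : realType) (Q : Type) (d : Q -> Q -> R) (o : Q) (r : R) :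
    set Q :=
  [set q | d o q <= r].

(* The centres are arbitrary points of Q, not necessarily in A. The value is
   +oo when A has no finite cover. *)
Definition covering_number (R : realType) (Q : Type) (A : set Q)
    (b : Q -> Q -> R) (r : R) : \bar R :=
  ereal_inf [set (k%:R)%:E | k in
    [set k : nat | exists q : 'I_k -> Q, A `<=` \bigcup_j cball b (q j) r]].

Section random_variables.
Context d d' (T : measurableType d) (V : measurableType d') (R : realType)
  (P : probability T R).

(* Only measurable A: outside the sigma-algebra the values of P are
   unspecified, so that [distribution P X = distribution P Y] would be too
   strong. *)
Definition identically_distributed (X Y : {RV P >-> V}) : Prop :=
  forall A : set V, measurable A -> distribution P X A = distribution P Y A.

Definition independent2 (X Y : {RV P >-> V}) : Prop :=
  forall A B : set V, measurable A -> measurable B ->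
    P (X @^-1` A `&` Y @^-1` B) = (P (X @^-1` A) * P (Y @^-1` B))%E.

Definition mutually_independent (I : finType) (X : I -> {RV P >-> V}) : Prop :=
  forall (J : {set I}) (A : I -> set V), (forall i, measurable (A i)) ->
    P (\bigcap_(i in [set` J]) (X i @^-1` A i)) =
    (\prod_(i in J) P (X i @^-1` A i))%E.

Definition risk (Q : Type) (c : V -> Q -> R) (Y : {RV P >-> V}) (q : Q) :
    \bar R :=
  ('E_P[fun w => c (Y w) q])%E.

Definition empirical_risk (Q : Type) (c : V -> Q -> R) (n : nat)
    (Y : 'I_n -> {RV P >-> V}) (w : T) (q : Q) : R :=
  n%:R^-1 * \sum_(i < n) c (Y i w) q.

Definition moment_functional (a : V * V -> R) (Y' Y : {RV P >-> V}) (zeta : R) :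
    \bar R :=
  (if (2 <= zeta)%R then 'E_P[fun w => (a (Y' w, Y w) `^ zeta)%R]
   else 'E_P[fun w => (a (Y' w, Y w) ^+ 2)%R] `^ (zeta / 2)%R)%E.

End random_variables.

Definition rate (R : realType) (beta : R) (n : nat) : R :=
  if beta < 1 then n%:R `^ (- 2^-1)
  else if beta == 1 then n%:R `^ (- 2^-1) * ln (n.+1)%:R
  else n%:R `^ (- (2 * beta)^-1).

(* Main.v *)
Require Import Defs.
From HB Require Import structures.
From mathcomp Require Import all_boot all_order all_algebra.
From mathcomp Require Import all_classical all_reals all_analysis.
From mathcomp Require Import measurable_realfun measurable_fun_approximation.
From mathcomp Require Import ring lra.

(** Write theta for gamma - alpha / beta, eta for the rate, F and F_n for the
    risk and the empirical risk, and M for the moment functional.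

    Peeling. Put s = t eta^(1/theta). If l m (mn w) lies in
    [2^k s, 2^(k+1) s), then the growth condition and the minimality of mn w
    for F_n force the centred process
    q |-> (F q - F m) - (F_n q - F_n m) to reach cg (2^k s)^gamma somewhere on
    the ball of l-radius delta = 2^(k+1) s around m. It therefore suffices to
    bound a zeta-th moment of the size of this process on such a ball by a
    constant times M (delta^(alpha/beta) eta)^zeta: Markov's inequality gives
    [shell_bound], and the bounds for the shells form a geometric series of
    ratio 2^(- zeta theta).

    Symmetrization. F is the mean of F_n over a ghost sample, realised on the
    second factor of T * T under the product measure. Jensen's inequality takes
    the zeta-th power inside the ghost integral. The law of the doubled sample
    does not change when some observations trade places with their ghosts
    ([integral_doubled_flips]), so the moment may be averaged over all 2^n
    exchange patterns. For a fixed doubled sample this average is an expectation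
    over random signs, and by the quadruple inequality the increments of the
    signed process between p and q are subgaussian at scale S b(p, q) / sqrt n,
    where S^2 is the mean of the squares of a over the sample.

    Chaining. Following nets of b-radius proportional to 2^-j from m to a level
    J bounds the process on the ball by its maximal increments along the links
    of consecutive nets, plus the radius of level J times the mean of a
    ([chain_dominates]). This bound, the envelope, is a finite expression in the
    data, so it is measurable, unlike a supremum over an arbitrary ball. Its
    moment over the signs is a Dudley sum times S^zeta ([envelope_moment]), and
    S^zeta integrates to at most M ([doubled_moment]).

    The rate. A covering number smaller than 2 is 1, hence the entropy condition
    bounds the b-diameter of the ball by a multiple of delta^(alpha/beta), and
    all radii are multiples of that number ([nets_of_entropy]). What remains is
    to choose J so that the Dudley sum n^(-1/2) sum_(j <= J) 2^((beta - 1) j)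
    and the truncation 2^-J are both of order eta, which is where the three
    regimes of the rate come from ([rate_levels]). *)

Set Implicit Arguments.
Unset Strict Implicit.
Unset Printing Implicit Defensive.

Import Order.TTheory GRing.Theory Num.Theory.
Import numFieldNormedType.Exports.

Local Open Scope classical_set_scope.
Local Open Scope ring_scope.

(** * Real powers and exponentials *)

Section powers.
Context {R : realType}.
Implicit Types (p x y z : R).

(** Young's inequality for the product of x and 1. *)
Lemma powR_bernoulli p x : 1 <= p -> 0 <= x -> p * x <= x `^ p + (p - 1).
Proof.
move=> p1 x0; have [->|pn1] := eqVneq p 1.
  by rewrite mul1r powRr1// subrr addr0.
have p0 : 0 < p by rewrite (lt_le_trans _ p1).
have p1' : 0 < p - 1 by rewrite subr_gt0 lt_neqAle eq_sym pn1.
have := @conjugate_powR R x 1 p (p / (p - 1)) x0 ler01 p0 (divr_gt0 p0 p1').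
rewrite powR1 mulr1 invf_div mul1r => /(_ _)/wrap[].
  by field; rewrite gt_eqF.
move=> h; rewrite -(ler_pM2l (_ : 0 < p^-1)) ?invr_gt0//.
rewrite mulKf ?gt_eqF// mulrDr; apply: le_trans h _.
by rewrite [_ * x `^ p]mulrC [p^-1 * _]mulrC.
Qed.

(** Convexity as a supporting line, from [powR_bernoulli] at x / y. Integrating or
    summing this affine bound, with y the mean or a bound on the mean, gives
    Jensen's inequality. *)
Lemma powR_tangent p x y : 1 <= p -> 0 <= x -> 0 < y ->
  p * y `^ (p - 1) * x <= x `^ p + (p - 1) * y `^ p.
Proof.
move=> p1 x0 y0; have p0 : 0 < p by rewrite (lt_le_trans _ p1).
have yp : 0 < y `^ p by rewrite powR_gt0.
have := powR_bernoulli p1 (divr_ge0 x0 (ltW y0)).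
rewrite -(ler_pM2r yp) mulrDl -powRM ?divr_ge0 ?(ltW y0)//.
rewrite divfK ?gt_eqF//; apply: le_trans; rewrite le_eqVlt; apply/orP; left.
rewrite -(mulr_powRB1 (ltW y0) p0); apply/eqP.
by field; rewrite gt_eqF.
Qed.

(** [powR_tangent] for the exponent p^-1, at the points x^p and y^p. *)
Lemma powR_tangent_concave p x y : 0 < p <= 1 -> 0 <= x -> 0 < y ->
  x `^ p <= p * y `^ (p - 1) * x + (1 - p) * y `^ p.
Proof.
move=> /andP[p0 p1] x0 y0.
have q1 : 1 <= p^-1 by rewrite invf_ge1.
have := powR_tangent q1 (powR_ge0 x p) (powR_gt0 p y0).
rewrite -!powRrM mulfV ?gt_eqF// !powRr1// ?(ltW y0)//.
rewrite mulrBr mulfV ?gt_eqF// mulr1.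
have yp : 0 < y `^ (1 - p) by rewrite powR_gt0.
have -> : y `^ (p - 1) = (y `^ (1 - p))^-1 by rewrite -powRN opprB.
have -> : y `^ p = y / y `^ (1 - p).
  rewrite -powRN opprB -{2}(powRr1 (ltW y0)) -powRD ?(gt_eqF y0) ?implybT//.
  by congr (_ `^ _); ring.
move=> h; rewrite -(ler_pM2l (mulr_gt0 (_ : 0 < p^-1) yp)) ?invr_gt0//.
apply: le_trans h _; rewrite le_eqVlt; apply/orP; left; apply/eqP.
by field; rewrite !gt_eqF.
Qed.

(** Sum the tangent inequality at the weighted mean. The first factor on the
    right is there because the weights are not normalised. *)
Lemma powR_jensen (I : eqType) (r : seq I) (P : pred I) (w x : I -> R) p :
  1 <= p -> (forall i, P i -> 0 <= w i) -> (forall i, P i -> 0 <= x i) ->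
  (\sum_(i <- r | P i) w i * x i) `^ p <=
  (\sum_(i <- r | P i) w i) `^ (p - 1) * \sum_(i <- r | P i) w i * x i `^ p.
Proof.
move=> p1 w0 x0; set W := \sum_(i <- r | P i) w i.
set X := \sum_(i <- r | P i) w i * x i.
have p0 : 0 < p by rewrite (lt_le_trans _ p1).
have W0 : 0 <= W by exact: sumr_ge0.
have X0 : 0 <= X by apply: sumr_ge0 => i Pi; rewrite mulr_ge0 ?w0 ?x0.
have RHS0 : 0 <= W `^ (p - 1) * \sum_(i <- r | P i) w i * x i `^ p.
  apply: mulr_ge0; first exact: powR_ge0.
  by apply: sumr_ge0 => i Pi; rewrite mulr_ge0 ?w0 ?powR_ge0.
have [Xz|X0'] := eqVneq X 0; first by rewrite Xz powR0 ?gt_eqF.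
have {X0'}X0' : 0 < X by rewrite lt_neqAle eq_sym X0'.
have WX : 0 < W.
  rewrite lt_neqAle W0 andbT; apply/eqP => /esym W0'; move: X0'.
  suff -> : X = 0 by rewrite ltxx.
  rewrite /X; apply: big1_seq => i /andP[Pi ir].
  have := W0'; rewrite /W => /eqP; rewrite psumr_eq0//.
  by move=> /allP/(_ _ ir)/implyP/(_ Pi)/eqP ->; rewrite mul0r.
pose y := X / W; have y0 : 0 < y by rewrite divr_gt0.
have h : \sum_(i <- r | P i) w i * (p * y `^ (p - 1) * x i) <=
    \sum_(i <- r | P i) w i * (x i `^ p + (p - 1) * y `^ p).
  by apply: ler_sum => i Pi; rewrite ler_wpM2l ?w0// powR_tangent ?x0.
move: h.
under eq_bigr do rewrite mulrCA.
rewrite -mulr_sumr -/X.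
under [leRHS]eq_bigr do rewrite mulrDr.
rewrite big_split/= -mulr_suml -/W.
have -> : p * y `^ (p - 1) * X = W * (p * y `^ p).
  rewrite -(mulr_powRB1 (ltW y0) p0) {2}/y.
  by field; rewrite gt_eqF.
rewrite addrC -lerBlDl -mulrBr.
rewrite [X in W * X](_ : _ = y `^ p); last by ring.
move=> h; have := ler_wpM2l (powR_ge0 W (p - 1)) h; apply: le_trans.
rewrite mulrA [_ * W]mulrC mulr_powRB1// -powRM// ?(ltW y0)//.
by rewrite /y mulrCA mulfV ?gt_eqF// mulr1.
Qed.

Lemma powRD_le p x y : 0 <= p -> 0 <= x -> 0 <= y ->
  (x + y) `^ p <= 2 `^ p * (x `^ p + y `^ p).
Proof.
move=> p0 x0 y0; wlog xy : x y x0 y0 / x <= y.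
  by move=> H; have [/H->//|/ltW/H] := leP x y; rewrite (addrC x) [y `^ p + _]addrC => ->.
apply: (@le_trans _ _ ((2 * y) `^ p)).
  by rewrite ge0_ler_powR ?nnegrE ?addr_ge0 ?mulr_ge0//; lra.
by rewrite powRM// ler_wpM2l ?powR_ge0// lerDr powR_ge0.
Qed.

(** Converts a bound on an exponential moment into one on the moment of order p. *)
Lemma powR_expR_bound p : 0 <= p ->
  exists2 C, 0 < C & forall x, 0 <= x -> x `^ p <= C * expR x.
Proof.
move=> p0; pose k := (Num.truncn p).+1.
have pk : p <= k%:R by rewrite ltW// truncnS_gt.
exists (1 + k`!%:R); first by rewrite ltr_pwDl.
move=> x x0; rewrite mulrDl mul1r.
have e1 : 1 <= expR x by rewrite -expR0 ler_expR.
have [x1|x1] := leP x 1.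
  apply: (@le_trans _ _ 1).
    have [->|xn0] := eqVneq x 0.
      by rewrite /powR eqxx; case: (p == 0); rewrite ?lexx ?ler01.
    have -> : 1 = 1 `^ p :> R by rewrite powR1.
    by rewrite ge0_ler_powR ?nnegrE.
  by apply: le_trans e1 _; rewrite lerDl mulr_ge0 ?expR_ge0.
apply: (@le_trans _ _ (x ^+ k)).
  by rewrite -powR_mulrn// ler_powR// ltW.
have := expR_ge1Dxn k.-1 x0; rewrite -/k => h.
apply: (@le_trans _ _ (k`!%:R * expR x)); last by rewrite lerDr expR_ge0.
rewrite -ler_pdivrMl ?ltr0n ?fact_gt0// mulrC.
by apply: le_trans h; rewrite lerDr.
Qed.

(** For small x, exp y <= 1 / (1 - y) at y = x and y = - x bounds the left-hand
    side by 1 / (1 - x^2); for the other x, both exponents are at most 2 x^2. *)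
Lemma cosh_le_expR x : (expR x + expR (- x)) / 2 <= expR (2 * x ^+ 2).
Proof.
have [h|h] := leP (x ^+ 2) (2^-1).
  have d0 : 0 < 1 - x ^+ 2 by lra.
  have x1 : -1 < x < 1 by apply/andP; split; nra.
  have e1 y : -1 < y < 1 -> expR y <= (1 - y)^-1.
    move=> /andP[y1 y2]; rewrite -[expR y]invrK -expRN lef_pV2 ?posrE ?expR_gt0//; last by lra.
    exact: expR_ge1Dx.
  apply: (@le_trans _ _ ((1 - x ^+ 2)^-1)).
    have -> : (1 - x ^+ 2)^-1 = ((1 - x)^-1 + (1 - - x)^-1) / 2.
      by field; apply/and3P; split; rewrite gt_eqF//; lra.
    rewrite ler_pM2r// lerD ?e1//; apply/andP; split; lra.
  rewrite -[leLHS]mul1r ler_pdivrMr//.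
  have := expR_ge1Dx (2 * x ^+ 2) => h2.
  have : (1 + 2 * x ^+ 2) * (1 - x ^+ 2) <= expR (2 * x ^+ 2) * (1 - x ^+ 2).
    by rewrite ler_wpM2r// ltW.
  by apply: le_trans; have := sqr_ge0 x; nra.
have nx : `|x| <= 2 * x ^+ 2.
  have : x ^+ 2 = `|x| ^+ 2 by rewrite real_normK ?num_real.
  by move=> ->; move: h; rewrite -(real_normK (num_real x)) => h; have := normr_ge0 x; nra.
have e y : y <= `|x| -> expR y <= expR (2 * x ^+ 2).
  by move=> yx; rewrite ler_expR (le_trans yx).
rewrite ler_pdivrMr// mulr_natr mulr2n lerD// e ?ler_norm//.
by rewrite -normrN ler_norm.
Qed.

End powers.

(** * Averages over random signs *)

Section finite_averages.
Context {R : realType}.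

Definition avg (S : finType) (f : S -> R) : R :=
  #|S|%:R^-1 * \sum_s f s.

Lemma avg_le (S : finType) (f g : S -> R) :
  (forall s, f s <= g s) -> avg f <= avg g.
Proof. by move=> fg; rewrite ler_wpM2l ?invr_ge0// ler_sum. Qed.

Lemma avg_ge0 (S : finType) (f : S -> R) : (forall s, 0 <= f s) -> 0 <= avg f.
Proof. by move=> f0; rewrite mulr_ge0 ?invr_ge0// sumr_ge0. Qed.

Lemma avgD (S : finType) (f g : S -> R) :
  avg (fun s => f s + g s) = avg f + avg g.
Proof. by rewrite /avg big_split/= mulrDr. Qed.

Lemma avgZ (S : finType) a (f : S -> R) : avg (fun s => a * f s) = a * avg f.
Proof. by rewrite /avg -mulr_sumr mulrCA. Qed.

Lemma avg_sum (S I : finType) (f : I -> S -> R) :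
  avg (fun s => \sum_i f i s) = \sum_i avg (f i).
Proof. by rewrite /avg exchange_big/= mulr_sumr. Qed.

Lemma avg_cst (S : finType) (a : R) : (0 < #|S|)%N -> avg (fun _ : S => a) = a.
Proof.
move=> S0; rewrite /avg sumr_const -[a *+ _]mulr_natl mulKf//.
by rewrite pnatr_eq0 -lt0n.
Qed.

Lemma avg_powR_le0 (S : finType) (f : S -> R) p : 0 < p ->
  (forall s, 0 <= f s) -> avg (fun s => f s `^ p) <= 0 -> forall s, f s = 0.
Proof.
move=> p0 f0 h s; have S0 : (0 < #|S|)%N by apply/card_gt0P; exists s.
have : \sum_s f s `^ p <= 0.
  by move: h; rewrite /avg pmulr_rle0// invr_gt0 ltr0n.
move=> h2; have /eqP : \sum_s f s `^ p = 0.
  by apply/eqP; rewrite eq_le h2 sumr_ge0// => ? _; rewrite powR_ge0.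
rewrite psumr_eq0; last by move=> ? _; rewrite powR_ge0.
by move=> /allP/(_ s (mem_index_enum _))/eqP/powR_eq0_eq0.
Qed.

(** Minkowski's inequality in the form used by chaining. It is Jensen's
    inequality for the convex combination of the U j / w j with weights
    proportional to w j. *)
Lemma avg_powR_sum (S J : finType) (U : J -> S -> R) (w : J -> R) p C :
  1 <= p -> (forall j s, 0 <= U j s) -> (forall j, 0 <= w j) -> 0 <= C ->
  (forall j, avg (fun s => U j s `^ p) <= C * w j `^ p) ->
  avg (fun s => (\sum_j U j s) `^ p) <= C * (\sum_j w j) `^ p.
Proof.
move=> p1 U0 w0 C0 h; have p0 : 0 < p by rewrite (lt_le_trans _ p1).
have Uw j s : U j s = w j * (U j s / w j).
  have [wz|wn] := eqVneq (w j) 0; last by rewrite mulrCA mulfV ?mulr1.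
  rewrite wz mul0r; apply: (avg_powR_le0 p0 (U0 j)).
  by apply: le_trans (h j) _; rewrite wz powR0 ?gt_eqF// mulr0.
set W := \sum_j w j; have W0 : 0 <= W by exact: sumr_ge0.
apply: (@le_trans _ _ (avg (fun s => W `^ (p - 1) *
    \sum_j w j * (U j s / w j) `^ p))).
  apply: avg_le => s; under eq_bigr do rewrite Uw.
  by apply: powR_jensen => // j _; rewrite divr_ge0.
rewrite avgZ avg_sum -(mulr_powRB1 W0 p0) mulrA [leRHS]mulrC.
rewrite ler_wpM2l ?powR_ge0// /W mulr_sumr ler_sum// => j _.
rewrite avgZ mulrC [leLHS]mulrC [leRHS]mulrC; apply: ler_wpM2l => //.
have -> : avg (fun s => (U j s / w j) `^ p) =
          (w j)^-1 `^ p * avg (fun s => U j s `^ p).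
  by rewrite -avgZ /avg; congr (_ * _); apply: eq_bigr => s _; rewrite powRM ?invr_ge0// mulrC.
have [wz|wn] := eqVneq (w j) 0; first by rewrite wz invr0 powR0 ?gt_eqF// mul0r.
apply: le_trans (ler_wpM2l (powR_ge0 _ _) (h j)) _.
rewrite mulrCA -powRM ?invr_ge0// mulVf// powR1 mulr1.
by [].
Qed.

End finite_averages.

Section rademacher.
Context {R : realType}.

(** The same patterns serve as signs, through the powers of - 1, and as the choice
    of the observations exchanged with their ghosts. *)
Definition signs n : finType := {ffun 'I_n -> bool}.

Lemma card_signs n : #|signs n| = (2 ^ n)%N.
Proof. by rewrite card_ffun card_bool card_ord. Qed.

Lemma signs_gt0 n : (0 < #|signs n|)%N.
Proof. by rewrite card_signs expn_gt0. Qed.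

Definition rad_sum n (v : 'I_n -> R) (s : signs n) : R :=
  \sum_i (-1) ^+ s i * v i.

(** Hoeffding's bound. The signs are independent: the average of the product over
    all patterns is the product of the averages, which are hyperbolic cosines. *)
Lemma rad_mgf n (v : 'I_n -> R) :
  avg (fun s => expR (rad_sum v s)) <= expR (2 * \sum_i v i ^+ 2).
Proof.
have -> : avg (fun s => expR (rad_sum v s)) =
    \prod_i ((expR (v i) + expR (- v i)) / 2).
  rewrite /avg card_signs big_split/= prodr_const card_ord mulrC.
  rewrite natrX -exprVn; congr (_ * _).
  under eq_bigr do rewrite expR_sum.
  rewrite -(bigA_distr_bigA (fun i (b : bool) => expR ((-1) ^+ b * v i))).
  by apply: eq_bigr => i _; rewrite big_bool expr1 expr0 mulN1r mul1r addrC.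
rewrite mulr_sumr expR_sum; apply: ler_prod => i _.
by rewrite cosh_le_expR andbT divr_ge0// addr_ge0// expR_ge0.
Qed.

Definition rad_max (K : finType) n (v : K -> 'I_n -> R) (s : signs n) : R :=
  \big[Num.max/0]_k `|rad_sum (v k) s|.

Lemma rad_max_ge0 (K : finType) n (v : K -> 'I_n -> R) s : 0 <= rad_max v s.
Proof. exact: bigmax_ge_id. Qed.

Lemma rad_sumZ n a (v : 'I_n -> R) s :
  rad_sum (fun i => a * v i) s = a * rad_sum v s.
Proof. by rewrite /rad_sum mulr_sumr; apply: eq_bigr => i _; rewrite mulrCA. Qed.

(** A maximal inequality, with lam in the role of the square root of the logarithm
    of the number of sums. For W the normalised maximum, a union bound gives an
    average of exp(lam^2 W) of at most 3 exp(3 lam^2). Since lam >= 1, this bounds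
    the average of exp(W - 3) and then that of the power of W. *)
Lemma rad_max_moment p : 1 <= p -> exists2 C, 0 < C &
  forall n (K : finType) (v : K -> 'I_n -> R) (tau lam : R),
    0 <= tau -> 1 <= lam -> (forall k, \sum_i v k i ^+ 2 <= tau ^+ 2) ->
    #|K|%:R <= expR (lam ^+ 2) ->
    avg (fun s => rad_max v s `^ p) <= C * (tau * lam) `^ p.
Proof.
move=> p1; have p0 : 0 < p by rewrite (lt_le_trans _ p1).
have [B B0 hB] := @powR_expR_bound R p (ltW p0).
exists (B * (4 * expR 3)); first by rewrite !mulr_gt0 ?expR_gt0.
move=> n K v tau lam; rewrite le_eqVlt => /predU1P[<-|tau0] lam1 hv hK.
  rewrite mul0r powR0 ?gt_eqF// mulr0.
  rewrite (_ : (fun s => _) = fun=> 0) ?avg_cst ?signs_gt0//.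
  apply/funext => s.
  suff -> : rad_max v s = 0 by rewrite powR0 ?gt_eqF.
  rewrite /rad_max big1_idem// => [|k _]; first by rewrite /= maxxx.
  rewrite /rad_sum big1 ?normr0// => i _.
  have := hv k; rewrite expr0n/= => h.
  have /eqP : \sum_i v k i ^+ 2 = 0.
    by apply/eqP; rewrite eq_le h sumr_ge0// => ? _; rewrite sqr_ge0.
  rewrite psumr_eq0 => [|? _]; last by rewrite sqr_ge0.
  by move=> /allP/(_ i (mem_index_enum _))/=; rewrite sqrf_eq0 => /eqP ->; rewrite mulr0.
have lam0 : 0 < lam by rewrite (lt_le_trans _ lam1).
have w0 : 0 < tau * lam by rewrite mulr_gt0.
pose W s := rad_max v s / (tau * lam).
have W0 s : 0 <= W s by rewrite divr_ge0 ?rad_max_ge0// ltW.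
have mgf k (e : R) : `|e| = 1 ->
    avg (fun s => expR (lam / tau * (e * rad_sum (v k) s))) <= expR (2 * lam ^+ 2).
  move=> e1; have := rad_mgf (fun i => lam / tau * (e * v k i)).
  have -> : (fun s => expR (rad_sum (fun i => lam / tau * (e * v k i)) s)) =
      (fun s => expR (lam / tau * (e * rad_sum (v k) s))).
    by apply/funext => s; rewrite !rad_sumZ.
  move=> h; apply: le_trans h _; rewrite ler_expR ler_pM2l//.
  have -> : \sum_i (lam / tau * (e * v k i)) ^+ 2 =
      (lam / tau) ^+ 2 * \sum_i v k i ^+ 2.
    rewrite mulr_sumr; apply: eq_bigr => i _.
    rewrite exprMn [(e * _) ^+ 2]exprMn.
    by rewrite -(real_normK (num_real e)) e1 expr1n mul1r.
  apply: le_trans (ler_wpM2l (sqr_ge0 _) (hv k)) _.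
  by rewrite -exprMn divfK ?gt_eqF.
have maxle s : expR (lam ^+ 2 * W s) <= 1 + \sum_k
    (expR (lam / tau * (1 * rad_sum (v k) s)) +
     expR (lam / tau * (-1 * rad_sum (v k) s))).
  have -> : lam ^+ 2 * W s = lam / tau * rad_max v s.
    by rewrite /W; field; rewrite !gt_eqF.
  rewrite /rad_max; apply: (big_ind (fun x => expR (lam / tau * x) <= _)).
  - rewrite mulr0 expR0 lerDl; apply: sumr_ge0 => k _.
    by apply: addr_ge0; exact: expR_ge0.
  - by move=> x y hx hy; rewrite /Num.max; case: ifP.
  - move=> k _; rewrite (bigD1 k)//= addrA.
    apply: ler_wpDr.
      by rewrite sumr_ge0// => i _; rewrite addr_ge0 ?expR_ge0.
    apply: ler_wpDl => //.
    have [h|h] := leP 0 (rad_sum (v k) s).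
      by rewrite mul1r ger0_norm// lerDl expR_ge0.
    by rewrite mulN1r ltr0_norm// lerDr expR_ge0.
have e3 : avg (fun s => expR (lam ^+ 2 * W s)) <= 3 * expR (3 * lam ^+ 2).
  apply: le_trans (avg_le maxle) _.
  rewrite avgD avg_cst ?signs_gt0// avg_sum.
  apply: (@le_trans _ _ (1 + \sum_(k : K) (2 * expR (2 * lam ^+ 2)))).
    rewrite lerD2l ler_sum// => k _; rewrite avgD mulr2n mulrDl mul1r lerD//.
      by rewrite mgf// normr1.
    by rewrite mgf// normrN1.
  rewrite sumr_const -[_ *+ #|_|]mulr_natl.
  apply: (@le_trans _ _ (1 + 2 * expR (3 * lam ^+ 2))).
    rewrite lerD2l mulrCA ler_pM2l// (_ : 3 * lam ^+ 2 = lam ^+ 2 + 2 * lam ^+ 2); last by ring.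
    by rewrite expRD ler_pM2r ?expR_gt0.
  have : 1 <= expR (3 * lam ^+ 2) by rewrite -[leLHS]expR0 ler_expR mulr_ge0 ?sqr_ge0.
  lra.
have lam21 : 1 <= lam ^+ 2 by rewrite expr_ge1// ltW.
have eW s : expR (W s) <= expR 3 * (1 + expR (- (3 * lam ^+ 2)) * expR (lam ^+ 2 * W s)).
  rewrite -expRD (_ : - _ + _ = lam ^+ 2 * (W s - 3)); last by ring.
  rewrite -[W s in leLHS](subrKC 3) expRD ler_pM2l ?expR_gt0//.
  have [h|h] := leP (W s - 3) 0.
    by apply: ler_wpDr; rewrite ?expR_ge0// -[leRHS]expR0 ler_expR.
  by apply: ler_wpDl => //; rewrite ler_expR ler_peMl// ltW.
have avgW : avg (fun s => expR (W s)) <= 4 * expR 3.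
  apply: le_trans (avg_le eW) _.
  rewrite avgZ avgD avg_cst ?signs_gt0// avgZ mulrC ler_pM2r ?expR_gt0//.
  have := ler_wpM2l (expR_ge0 (- (3 * lam ^+ 2))) e3.
  rewrite [leRHS]mulrCA -expRD addNr expR0; lra.
have -> : (fun s => rad_max v s `^ p) = (fun s => (tau * lam) `^ p * W s `^ p).
  apply/funext => s; rewrite -powRM ?(ltW w0)//.
  by rewrite /W mulrCA mulfV ?gt_eqF// mulr1.
rewrite avgZ mulrC ler_pM2r ?powR_gt0//.
apply: (@le_trans _ _ (avg (fun s => B * expR (W s)))).
  by apply: avg_le => s; exact: hB.
by rewrite avgZ ler_pM2l.
Qed.

End rademacher.

(** * Chaining *)

Section chaining.
Context {R : realType} {Q : Type}.
Implicit Types (b : Q -> Q -> R) (f : Q -> R).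

(** The increment of f between a point of one net and a point of the next. A pair
    at distance more than r contributes 0, so that the maximum over the links can
    be taken over the whole product of the index types. *)
Definition link b (r : R) N1 N2 (u : 'I_N1 -> Q) (v : 'I_N2 -> Q) f
    (k : 'I_N1 * 'I_N2) : R :=
  if b (u k.1) (v k.2) <= r then f (u k.1) - f (v k.2) else 0.

Lemma linkZ b r N1 N2 (u : 'I_N1 -> Q) (v : 'I_N2 -> Q) a f k :
  link b r u v (fun q => a * f q) k = a * link b r u v f k.
Proof. by rewrite /link; case: ifP => _; rewrite ?mulr0// mulrBr. Qed.

Definition chain b (rho : nat -> R) (N : nat -> nat)
    (net : forall j, 'I_(N j) -> Q) J n (x : 'I_n -> Q -> R) : R :=
  \sum_(j < J) \big[Num.max/0]_k
    `|n%:R^-1 * \sum_i link b (3 * rho j.+1) (@net j.+1) (@net j) (x i) k|.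

Lemma chain_ge0 b rho N (net : forall j, 'I_(N j) -> Q) J n (x : 'I_n -> Q -> R) :
  0 <= chain b rho net J x.
Proof. by apply: sumr_ge0 => j _; exact: bigmax_ge_id. Qed.

(** Telescope x along points of the nets close to q, from level 0 (the point m) to
    level J. Two successive points are at distance at most
    rho (j + 1) + rho j = 3 rho (j + 1), so they form a link; the step from the
    last one to q is controlled by the Lipschitz bound. *)
Lemma chain_dominates b rho N (net : forall j, 'I_(N j) -> Q) J n
    (x : 'I_n -> Q -> R) (a : 'I_n -> R) m q :
  pseudometric b -> (forall j, rho j = 2 * rho j.+1) ->
  (forall i p q, `|x i p - x i q| <= a i * b p q) ->
  (forall k, @net 0 k = m) -> (forall i, 0 <= a i) ->
  (forall j, exists k, b (@net j k) q <= rho j) ->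
  n%:R^-1 * \sum_i (x i q - x i m) <=
  chain b rho net J x + rho J * (n%:R^-1 * \sum_i a i).
Proof.
move=> [b0 _ bC btri] rhoS hx net0 a0 covered.
pose k j := sval (cid (covered j)).
have hk j : b (@net j (k j)) q <= rho j by exact: (svalP (cid (covered j))).
pose f p := n%:R^-1 * \sum_i x i p.
have n0 : 0 <= n%:R^-1 :> R by rewrite invr_ge0.
have -> : n%:R^-1 * \sum_i (x i q - x i m) =
    (\sum_(j < J) (f (@net j.+1 (k j.+1)) - f (@net j (k j)))) +
    (f q - f (@net J (k J))).
  rewrite -(big_mkord xpredT (fun j => f (@net j.+1 (k j.+1)) - f (@net j (k j)))).
  rewrite (telescope_sumr (fun j => f (@net j (k j))))// net0.
  by rewrite sumrB mulrBr -/(f q) -/(f m); ring.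
apply: lerD.
  apply: ler_sum => j _.
  apply: le_trans (le_bigmax _ _ (k j.+1, k j)).
  have close : b (@net j.+1 (k j.+1)) (@net j (k j)) <= 3 * rho j.+1.
    apply: le_trans (btri _ q _) _; rewrite [b q _]bC.
    by apply: le_trans (lerD (hk _) (hk _)) _; rewrite (rhoS j); lra.
  under [X in _ <= `|_ * X|]eq_bigr do rewrite /link/= close.
  by rewrite sumrB mulrBr ler_norm.
rewrite /f -mulrBr -sumrB mulrCA ler_wpM2l//.
rewrite mulr_sumr ler_sum// => i _.
apply: le_trans (ler_norm _) _; apply: le_trans (hx _ _ _) _.
by rewrite mulrC ler_wpM2r// bC.
Qed.

End chaining.

(** Dudley's bound. At level j the coefficients have sum of squares at most
    (3 rho (j + 1) S)^2 / n, so [rad_max_moment] applies with the square root of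
    this number as tau; the levels are added by [avg_powR_sum]. *)
Lemma chain_moment (R : realType) (p : R) : 1 <= p -> exists2 C, 0 < C &
  forall (Q : Type) (b : Q -> Q -> R) (rho lam : nat -> R) N
    (net : forall j, 'I_(N j) -> Q) J n
    (x : 'I_n -> Q -> R) (a : 'I_n -> R) (S : R),
  (0 < n)%N -> (forall j, 0 <= rho j) -> (forall j, 1 <= lam j) ->
  (forall i p q, `|x i p - x i q| <= a i * b p q) ->
  (forall i, 0 <= a i) ->
  0 <= S -> n%:R^-1 * \sum_i a i ^+ 2 <= S ^+ 2 ->
  (forall j, (N j.+1 * N j)%:R <= expR (lam j ^+ 2)) ->
  avg (fun s : signs n => chain b rho net J (fun i q => (-1) ^+ s i * x i q) `^ p)
  <= C * (S * (n%:R `^ (- 2^-1) * \sum_(j < J) 3 * rho j.+1 * lam j)) `^ p.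
Proof.
move=> p1; have [C C0 hC] := @rad_max_moment R p p1; exists C => //.
move=> Q b rho lam N net J n x a S n0 rho0 lam1 hx a0 S0 hS hN.
have nR0 : 0 < n%:R :> R by rewrite ltr0n.
pose nh := n%:R `^ (- 2^-1) : R.
have nh0 : 0 <= nh by exact: powR_ge0.
have nh2 : nh ^+ 2 = n%:R^-1.
  by rewrite -powR_mulrn// -powRrM mulNr mulVf// powR_inv1// ltW.
pose v (j : 'I_J) k (i : 'I_n) := n%:R^-1 *
  link b (3 * rho j.+1) (@net j.+1) (@net j) (x i) k.
have -> : (fun s : signs n =>
      chain b rho net J (fun i q => (-1) ^+ s i * x i q) `^ p) =
    (fun s => (\sum_(j < J) rad_max (v j) s) `^ p).
  apply/funext => s; congr (_ `^ _); apply: eq_bigr => j _.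
  apply: eq_bigr => k _; congr `|_|.
  rewrite /rad_sum mulr_sumr; apply: eq_bigr => i _.
  by rewrite linkZ mulrCA.
have -> : S * (nh * \sum_(j < J) 3 * rho j.+1 * lam j) =
    \sum_(j < J) (S * nh * (3 * rho j.+1)) * lam j.
  by rewrite mulrA mulr_sumr; apply: eq_bigr => j _; rewrite mulrA.
apply: avg_powR_sum => //.
- by move=> j s; exact: rad_max_ge0.
- by move=> j; rewrite !mulr_ge0// (le_trans ler01).
- exact: ltW.
move=> j; apply: hC => //.
- by rewrite !mulr_ge0.
- move=> k; rewrite !exprMn nh2.
  apply: (@le_trans _ _ (\sum_i (n%:R^-1 * (a i * (3 * rho j.+1))) ^+ 2)).
    apply: ler_sum => i _; rewrite -[leLHS]real_normK ?num_real//.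
    rewrite lerXn2r ?nnegrE ?normr_ge0 ?mulr_ge0 ?invr_ge0//.
    rewrite normrM ger0_norm ?invr_ge0// ler_wpM2l ?invr_ge0//.
    rewrite /link; case: ifP => h; last by rewrite normr0 !mulr_ge0.
    by apply: le_trans (hx _ _ _) _; rewrite ler_wpM2l.
  have -> : \sum_i (n%:R^-1 * (a i * (3 * rho j.+1))) ^+ 2 =
      n%:R^-1 * (3 ^+ 2 * rho j.+1 ^+ 2) * (n%:R^-1 * \sum_i a i ^+ 2).
    by rewrite !mulr_sumr; apply: eq_bigr => i _; ring.
  rewrite [leRHS](_ : _ = n%:R^-1 * (3 ^+ 2 * rho j.+1 ^+ 2) * S ^+ 2).
    by rewrite ler_wpM2l// !mulr_ge0 ?invr_ge0 ?sqr_ge0.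
  by ring.
- by rewrite card_prod !card_ord.
Qed.

(** * Exchanging a sample with its ghost *)

Section symmetrization.
Context {d d' : measure_display} {T : measurableType d} {V : measurableType d'}
  {R : realType} (P : probability T R).
Local Open Scope ereal_scope.

Definition flip (s : bool) (z : V * V) : V * V := if s then (z.2, z.1) else z.

Definition flips n (s : {ffun 'I_n -> bool}) (z : n.-tuple (V * V)) :
    n.-tuple (V * V) :=
  [tuple flip (s i) (tnth z i) | i < n].

(** The observations and their ghosts, an independent copy on the second factor. *)
Definition doubled n (X : 'I_n -> {RV P >-> V}) (w : T * T) : n.-tuple (V * V) :=
  [tuple (X i w.1, X i w.2) | i < n].

Lemma measurable_flip s : measurable_fun setT (flip s).
Proof.
case: s; last exact: measurable_id.
exact: (measurable_fun_pair measurable_snd measurable_fst).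
Qed.

Lemma measurable_flips n (s : {ffun 'I_n -> bool}) : measurable_fun setT (flips s).
Proof.
apply/measurable_fun_tnthP => i.
rewrite [X in measurable_fun _ X](_ : _ = flip (s i) \o (@tnth _ _ ^~ i)).
  by apply: measurableT_comp; [exact: measurable_flip|exact: measurable_tnth].
by apply/funext => z /=; rewrite tnth_mktuple.
Qed.

Lemma measurable_doubled n (X : 'I_n -> {RV P >-> V}) :
  measurable_fun setT (doubled X).
Proof.
apply/measurable_fun_tnthP => i.
rewrite [X in measurable_fun _ X](_ : _ = fun w => (X i w.1, X i w.2)).
  by apply: measurable_fun_pair; apply: measurableT_comp.
by apply/funext => z /=; rewrite tnth_mktuple.
Qed.

(** A pi-system that generates the product sigma-algebra, on which the law of the
    doubled sample is explicit. *)
Definition boxes n : set (set (n.-tuple (V * V))) :=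
  [set A | exists B : 'I_n -> set V, exists2 C : 'I_n -> set V,
    (forall i, measurable (B i) /\ measurable (C i)) &
    A = [set z | forall i, B i (tnth z i).1 /\ C i (tnth z i).2]].

Lemma boxesI n : setI_closed (@boxes n).
Proof.
move=> _ _ [B1 [C1 m1 ->]] [B2 [C2 m2 ->]].
exists (fun i => B1 i `&` B2 i); exists (fun i => C1 i `&` C2 i).
  by move=> i; have [? ?] := m1 i; have [? ?] := m2 i; split; exact: measurableI.
apply/seteqP; split => z.
  by move=> [h1 h2] i; have [? ?] := h1 i; have [? ?] := h2 i.
by move=> h; split => i; have [[? ?] [? ?]] := h i.
Qed.

Lemma boxesT n : @boxes n setT.
Proof.
by exists (fun=> setT); exists (fun=> setT) => //; apply/seteqP; split.
Qed.

Lemma measurable_tuple_boxes n :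
  @measurable _ (n.-tuple (V * V)) = <<s @boxes n >>.
Proof.
apply/seteqP; split.
  apply: smallest_sub; first exact: smallest_sigma_algebra.
  rewrite -bigcup_seq => A [i _ [D mD <-]]; rewrite setTI.
  pose G : set (set (V * V)) := [set D | <<s @boxes n >> ((@tnth _ _ ^~ i) @^-1` D)].
  suff : measurable `<=` G by exact.
  rewrite measurable_prod_measurableType; apply: smallest_sub.
    split.
    - by rewrite /G/= preimage_set0; exact: sigma_algebra0.
    - by move=> E GE; rewrite /G/= setTD preimage_setC; exact: sigma_algebraC.
    - by move=> F GF; rewrite /G/= preimage_bigcup; exact: sigma_algebra_bigcup.
  move=> _ [B mB [C mC <-]]; apply: sub_sigma_algebra.
  exists (fun j => if j == i then B else setT).
  exists (fun j => if j == i then C else setT).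
    by move=> j; case: eqP => _; split.
  apply/seteqP; split => z /=.
    by move=> [h1 h2] j; case: eqP => [->|].
  by move=> /(_ i); rewrite eqxx.
apply: smallest_sub; first exact: sigma_algebra_measurable.
move=> _ [B [C m ->]].
rewrite [X in measurable X](_ : _ = \bigcap_(i : 'I_n)
    ((@tnth _ _ ^~ i) @^-1` (B i `*` C i))).
  apply: fin_bigcap_measurable => // i _; have [mB mC] := m i.
  by rewrite -[X in measurable X]setTI; apply: measurable_tnth => //; exact: measurableX.
by apply/seteqP; split => z h i => [_|]; exact: h.
Qed.

Lemma doubled_boxE n (X : 'I_n -> {RV P >-> V}) (s : {ffun 'I_n -> bool})
    (B C : 'I_n -> set V) : mutually_independent X ->
  (forall i, measurable (B i) /\ measurable (C i)) ->
  (P \x P) ((flips s \o doubled X) @^-1`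
    [set z | forall i, B i (tnth z i).1 /\ C i (tnth z i).2]) =
  \prod_i (P (X i @^-1` B i) * P (X i @^-1` C i)).
Proof.
move=> indep m.
pose J : {set 'I_n} := finset.setT.
pose B' i := if s i then C i else B i.
pose C' i := if s i then B i else C i.
have mB' i : measurable (B' i) by rewrite /B'; have [] := m i; case: (s i).
have mC' i : measurable (C' i) by rewrite /C'; have [] := m i; case: (s i).
have -> : (flips s \o doubled X) @^-1`
    [set z | forall i, B i (tnth z i).1 /\ C i (tnth z i).2] =
    (\bigcap_(i in [set` J]) (X i @^-1` B' i)) `*`
    (\bigcap_(i in [set` J]) (X i @^-1` C' i)).
  apply/seteqP; split => w /=.
    move=> h; split => i _; have := h i; rewrite !tnth_mktuple /flip /B' /C'.
      by case: (s i) => -[].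
    by case: (s i) => -[].
  move=> [h1 h2] i; rewrite !tnth_mktuple /flip.
  have := h1 i; have := h2 i; rewrite /B' /C' /= /J finset.in_setT.
  by case: (s i) => /(_ isT) ? /(_ isT) ?.
have mcap (D : 'I_n -> set V) : (forall i, measurable (D i)) ->
    measurable (\bigcap_(i in [set` J]) (X i @^-1` D i)).
  move=> mD; apply: fin_bigcap_measurable => // i _.
  by rewrite -[X in measurable X]setTI; exact: measurable_funP.
rewrite product_measure1E; [|exact: mcap..].
transitivity ((\prod_(i in J) P (X i @^-1` B' i)) *
              (\prod_(i in J) P (X i @^-1` C' i))).
  by congr (_ * _); [exact: (indep J B' mB')|exact: (indep J C' mC')].
rewrite -big_split/=.
rewrite (eq_bigl xpredT); last by move=> i; rewrite finset.in_setT.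
by apply: eq_bigr => i _; rewrite /B' /C'; case: (s i); rewrite // muleC.
Qed.

Lemma flips0 n (z : n.-tuple (V * V)) : flips [ffun=> false] z = z.
Proof. by apply: eq_from_tnth => i; rewrite tnth_mktuple ffunE. Qed.

(** On a box, the law of the doubled sample is a product of factors each symmetric
    in an observation and its ghost ([doubled_boxE]). Two laws that agree on the
    boxes are equal. *)
Lemma integral_doubled_flips n (X : 'I_n -> {RV P >-> V})
    (s : {ffun 'I_n -> bool}) (f : n.-tuple (V * V)%type -> \bar R) : mutually_independent X ->
  measurable_fun [set: n.-tuple (V * V)%type] f -> (forall z, 0 <= f z) ->
  \int[P \x P]_w f (flips s (doubled X w)) = \int[P \x P]_w f (doubled X w).
Proof.
move=> indep mf f0.
have mfd s' : measurable_fun setT (flips s' \o doubled X).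
  by apply: measurableT_comp; [exact: measurable_flips|exact: measurable_doubled].
pose PP : probability (T * T)%type R := P \x P.
pose Z s' : {mfun (T * T)%type >-> n.-tuple (V * V)%type} :=
  HB.pack (flips s' \o doubled X) (isMeasurableFun.Build _ _ _ _ _ (mfd s')).
have intE s' : \int[P \x P]_w f (flips s' (doubled X w)) =
    \int[distribution PP (Z s')]_z f z by rewrite ge0_integral_distribution.
rewrite [RHS](_ : _ = \int[P \x P]_w f (flips [ffun=> false] (doubled X w))).
  rewrite !intE; apply: eq_measure_integral => //= A mA _.
  suff : distribution PP (Z s) A = distribution PP (Z [ffun=> false]) A by [].
  apply: (measure_unique (@boxes n) (fun=> setT)) => //.
  - exact: measurable_tuple_boxes.
  - exact: boxesI.
  - by move=> _; exact: boxesT.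
  - by rewrite bigcup_const.
  - by move=> _ [B [C mBC ->]]; rewrite /distribution /pushforward/= !doubled_boxE.
  - move=> _; exact: (le_lt_trans (probability_le1 (distribution PP (Z s)) measurableT) (ltry 1)).
by apply: eq_integral => w _; rewrite flips0.
Qed.

End symmetrization.

(** * Jensen's inequality and the moment of the doubled sample *)

Section jensen.
Context {d : measure_display} {T : measurableType d} {R : realType}
  (P : probability T R).
Local Open Scope ereal_scope.

Lemma ge0_integral_affine (f : T -> R) (a b : R) : (forall x, 0 <= f x)%R ->
  measurable_fun setT f -> (0 <= a)%R -> (0 <= b)%R ->
  \int[P]_x (a * f x + b)%:E = a%:E * \int[P]_x (f x)%:E + b%:E.
Proof.
move=> f0 mf a0 b0.
under eq_integral do rewrite EFinD EFinM.
rewrite ge0_integralD//; last first.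
- by apply: measurable_funeM; exact/measurable_EFinP.
- by move=> x _; rewrite -EFinM lee_fin mulr_ge0.
rewrite ge0_integralZl_EFin//; last 2 first.
- by move=> x _; rewrite lee_fin.
- exact/measurable_EFinP.
by rewrite integral_cst//= probability_setT mule1.
Qed.

Lemma measurable_fun_powR (f : T -> R) p : measurable_fun setT f ->
  measurable_fun setT (fun x => f x `^ p)%R.
Proof. by move=> mf; apply: (measurableT_comp (@measurable_powR R p)). Qed.

(** Jensen's inequality, from the tangent at x. The hypothesis is only a lower
    bound on the mean, which may be infinite. *)
Lemma integral_powR_ge (f : T -> R) p x : (1 <= p)%R -> (0 < x)%R ->
  (forall w, 0 <= f w)%R -> measurable_fun setT f ->
  x%:E <= \int[P]_w (f w)%:E -> (x `^ p)%:E <= \int[P]_w (f w `^ p)%:E.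
Proof.
move=> p1 x0 f0 mf xf; have p0 : (0 < p)%R by rewrite (lt_le_trans _ p1).
have c0 : (0 <= p * x `^ (p - 1))%R by rewrite mulr_ge0 ?powR_ge0// ltW.
have c1 : (0 <= (p - 1) * x `^ p)%R by rewrite mulr_ge0 ?powR_ge0// subr_ge0.
have : (p * x `^ (p - 1))%:E * \int[P]_w (f w)%:E + 0%:E <=
    1%:E * \int[P]_w (f w `^ p)%:E + ((p - 1) * x `^ p)%:E.
  rewrite -!ge0_integral_affine//; last 2 first.
  - by move=> w; exact: powR_ge0.
  - exact: measurable_fun_powR.
  apply: ge0_le_integral => //.
  - by move=> w _; rewrite lee_fin addr0 mulr_ge0.
  - apply/measurable_EFinP; apply: measurable_funD => //.
    exact: measurable_funM.
  - apply/measurable_EFinP; apply: measurable_funD => //.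
    by apply: measurable_funM => //; exact: measurable_fun_powR.
  - by move=> w _; rewrite lee_fin addr0 mul1r powR_tangent.
rewrite adde0 mul1e -leeBlDr// => h.
apply: le_trans h; rewrite leeBrDr//.
apply: (@le_trans _ _ ((p * x `^ (p - 1))%:E * x%:E)).
  rewrite -EFinM -EFinD lee_fin -(mulr_powRB1 (ltW x0) p0); lra.
by rewrite lee_wpmul2l// lee_fin.
Qed.

(** Jensen's inequality for a concave power, from the tangent at any v above the
    mean; the case of mean 0 follows by letting v tend to 0. *)
Lemma integral_powR_le (f : T -> R) p : (0 < p <= 1)%R ->
  (forall w, 0 <= f w)%R -> measurable_fun setT f ->
  \int[P]_w (f w `^ p)%:E <= (\int[P]_w (f w)%:E) `^ p.
Proof.
move=> /andP[p0 p1] f0 mf.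
have main (v : R) : (0 < v)%R -> \int[P]_w (f w)%:E <= v%:E ->
    \int[P]_w (f w `^ p)%:E <= (v `^ p)%:E.
  move=> v0 fv.
  have c0 : (0 <= p * v `^ (p - 1))%R by rewrite mulr_ge0 ?powR_ge0// ltW.
  have c1 : (0 <= (1 - p) * v `^ p)%R by rewrite mulr_ge0 ?powR_ge0// subr_ge0.
  apply: (@le_trans _ _ (\int[P]_w (p * v `^ (p - 1) * f w + (1 - p) * v `^ p)%:E)).
    apply: ge0_le_integral => //.
    - by move=> w _; rewrite lee_fin powR_ge0.
    - by apply/measurable_EFinP; exact: measurable_fun_powR.
    - apply/measurable_EFinP; apply: measurable_funD => //.
      exact: measurable_funM.
    - by move=> w _; rewrite lee_fin powR_tangent_concave// p0.
  rewrite ge0_integral_affine//.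
  apply: (@le_trans _ _ ((p * v `^ (p - 1))%:E * v%:E + ((1 - p) * v `^ p)%:E)).
    by rewrite leeD2r// lee_wpmul2l// lee_fin.
  rewrite -EFinM -EFinD lee_fin -(mulr_powRB1 (ltW v0) p0); lra.
have : 0 <= \int[P]_w (f w)%:E by apply: integral_ge0 => w _; rewrite lee_fin.
move: main; case: (\int[P]_w (f w)%:E) => [v|_ _|//]; last first.
  by rewrite poweRyr ?leey// gt_eqF.
rewrite lee_fin le_eqVlt => /[swap] /predU1P[<-|v0] main; last first.
  by rewrite poweR_EFin; exact: main.
apply/lee_addgt0Pr => e e0; rewrite poweR_EFin powR0 ?gt_eqF// add0e.
have := main (e `^ p^-1)%R; rewrite -powRrM mulVf ?gt_eqF// powRr1 ?(ltW e0)//.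
by apply; rewrite ?powR_gt0// lee_fin powR_ge0.
Qed.

End jensen.

Lemma sum_cst_ord (R : realType) n (x : \bar R) : (0 <= x)%E ->
  (\sum_(i < n) x = n%:R%:E * x)%E.
Proof.
move=> x0; elim: n => [|n ih]; first by rewrite big_ord0 mul0e.
by rewrite big_ord_recr/= ih -natr1 EFinD ge0_muleDl ?mul1e// lee_fin.
Qed.

Section doubled_moment.
Context {d d' : measure_display} {T : measurableType d} {V : measurableType d'}
  {R : realType} (P : probability T R).
Local Open Scope ereal_scope.

(** Both sides integrate g against the product of the law of Y with itself. *)
Lemma integral_doubled_pair (X Y Y' : {RV P >-> V}) (g : V * V -> \bar R) :
  identically_distributed X Y -> identically_distributed Y' Y ->
  independent2 Y' Y -> measurable_fun setT g -> (forall z, 0 <= g z) ->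
  \int[P \x P]_w g (X w.1, X w.2) = \int[P]_w g (Y' w, Y w).
Proof.
move=> XY Y'Y ind mg g0.
pose PP : probability (T * T)%type R := P \x P.
have mX2 : measurable_fun setT (fun w : T * T => (X w.1, X w.2)).
  by apply: measurable_fun_pair; apply: measurableT_comp.
have mY2 : measurable_fun setT (fun w : T => (Y' w, Y w)).
  exact: measurable_fun_pair.
pose X2 : {mfun (T * T)%type >-> (V * V)%type} :=
  HB.pack (fun w : T * T => (X w.1, X w.2)) (isMeasurableFun.Build _ _ _ _ _ mX2).
pose Y2 : {mfun T >-> (V * V)%type} :=
  HB.pack (fun w : T => (Y' w, Y w)) (isMeasurableFun.Build _ _ _ _ _ mY2).
transitivity (\int[distribution PP X2]_z g z).
  by rewrite ge0_integral_distribution.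
transitivity (\int[distribution P Y2]_z g z); last first.
  by rewrite ge0_integral_distribution.
pose mu := distribution P Y.
have mpre (U : {RV P >-> V}) (A : set V) : measurable A -> measurable (U @^-1` A).
  by move=> mA; rewrite -[X in measurable X]setTI; exact: measurable_funP.
apply: eq_measure_integral => //= A mA _.
transitivity ((mu \x mu) A); last first.
  apply: product_measure_unique => // B C mB mC.
  transitivity (distribution P Y' B * distribution P Y C); first exact: ind.
  by rewrite Y'Y.
apply/esym.
suff h : forall B C, measurable B -> measurable C ->
    distribution PP X2 (B `*` C) = mu B * mu C.
  exact: (@product_measure_unique _ _ _ _ R mu mu (distribution PP X2) h A mA).
move=> B C mB mC.
transitivity (distribution P X B * distribution P X C); last by rewrite !XY.
have := @product_measure1E _ _ _ _ R P P _ _ (mpre X B mB) (mpre X C mC).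
exact.
Qed.

(** The quadruple on the left of the weak quadruple condition is unchanged when
    y, z and q, p are exchanged simultaneously, so the condition also holds with
    this smaller function, which does not see whether an observation and its
    ghost have been exchanged. *)
Definition sym_quad (a : V * V -> R) (z : V * V) : R :=
  Num.min (a z) (a (z.2, z.1)).

Lemma sym_quad_flip a s z : sym_quad a (flip s z) = sym_quad a z.
Proof.
by case: s => //; rewrite /sym_quad /flip /= minC; case: z.
Qed.

Lemma measurable_sym_quad a : measurable_fun setT a ->
  measurable_fun setT (sym_quad a).
Proof.
move=> ma; apply: measurable_minr => //; apply: measurableT_comp => //.
exact: (measurable_fun_pair measurable_snd measurable_fst).
Qed.

(** The two cases of the moment functional correspond to two uses of Jensen's
    inequality: over the index i if zeta >= 2, over the probability space if
    zeta < 2. *)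
Lemma doubled_moment (Y Y' : {RV P >-> V}) n (X : 'I_n -> {RV P >-> V})
    (a : V * V -> R) zeta :
  (0 < n)%N -> (forall i, identically_distributed (X i) Y) ->
  identically_distributed Y' Y -> independent2 Y' Y ->
  measurable_fun setT a -> (forall y z, 0 <= a (y, z))%R -> (1 <= zeta)%R ->
  \int[P \x P]_w
    ((n%:R^-1 * \sum_i sym_quad a (tnth (doubled X w) i) ^+ 2) `^ (zeta / 2))%:E
  <= moment_functional a Y' Y zeta.
Proof.
move=> n0 XY Y'Y ind ma a0 zeta1.
pose PP : probability (T * T)%type R := P \x P.
have nR0 : (0 < n%:R :> R)%R by rewrite ltr0n.
pose A i w := sym_quad a (X i w.1, X i w.2).
have a0' z : (0 <= a z)%R by case: z.
have A0 i w : (0 <= A i w)%R by rewrite /A /sym_quad le_min !a0'.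
have mA i : measurable_fun setT (A i).
  apply: (measurableT_comp (measurable_sym_quad ma)).
  by apply: measurable_fun_pair; apply: measurableT_comp.
pose S w := (n%:R^-1 * \sum_i A i w ^+ 2)%R.
have S0 w : (0 <= S w)%R.
  by rewrite mulr_ge0 ?invr_ge0// sumr_ge0// => i _; rewrite sqr_ge0.
have mS : measurable_fun setT S.
  by apply: measurable_funM => //; apply: measurable_sum => i; exact: measurable_funX.
rewrite [leLHS](_ : _ = \int[PP]_w (S w `^ (zeta / 2))%:E); last first.
  apply: eq_integral => w _; rewrite /S /A; congr ((_ * _) `^ _)%:E.
  by apply: eq_bigr => i _; rewrite tnth_mktuple.
have avg_int (g : R -> R) : (forall u, 0 <= u -> 0 <= g u)%R ->
    measurable_fun setT g ->
    (forall u v, 0 <= u -> u <= v -> g u <= g v)%R ->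
    \int[PP]_w (n%:R^-1 * \sum_i g (A i w))%:E <=
    \int[P]_w (g (a (Y' w, Y w)))%:E.
  move=> g0 mg gmon.
  have mgA i : measurable_fun setT (fun w => g (A i w)) by exact: measurableT_comp.
  under eq_integral do rewrite EFinM -sumEFin.
  rewrite ge0_integralZl_EFin ?invr_ge0//; last 2 first.
  - by move=> w _; apply: sume_ge0 => i _; rewrite lee_fin g0.
  - by apply: emeasurable_sum => i; exact/measurable_EFinP.
  rewrite ge0_integral_sum//; last 2 first.
  - by move=> i; exact/measurable_EFinP.
  - by move=> i w _; rewrite lee_fin g0.
  apply: (@le_trans _ _ (n%:R^-1%:E * \sum_(i < n) \int[P]_w (g (a (Y' w, Y w)))%:E)).
    rewrite lee_wpmul2l ?lee_fin ?invr_ge0//; apply: lee_sum => i _.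
    rewrite -(integral_doubled_pair (g := fun z => (g (a z))%:E) (XY i) Y'Y ind)//.
    - apply: ge0_le_integral => //.
      + by move=> w _; rewrite lee_fin g0.
      + exact/measurable_EFinP.
      + apply/measurable_EFinP; apply: measurableT_comp => //.
        apply: measurableT_comp => //.
        by apply: measurable_fun_pair; apply: measurableT_comp.
      + by move=> w _; rewrite lee_fin gmon// /A /sym_quad ge_min lexx.
    - by apply/measurable_EFinP; apply: measurableT_comp.
    - by move=> z; rewrite lee_fin g0.
  rewrite sum_cst_ord ?muleA -?EFinM ?mulVf ?gt_eqF// ?mul1e//.
  by apply: integral_ge0 => w _; rewrite lee_fin g0.
rewrite /moment_functional unlock; case: ifPn => z2.
  have z2' : (1 <= zeta / 2)%R by rewrite ler_pdivlMr// mul1r.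
  apply: le_trans (avg_int (fun u => u `^ zeta)%R _ _ _).
  - apply: ge0_le_integral => //.
    + by move=> w _; rewrite lee_fin powR_ge0.
    + by apply/measurable_EFinP; exact: measurable_fun_powR.
    + apply/measurable_EFinP; apply: measurable_funM => //.
      by apply: measurable_sum => i; exact: measurable_fun_powR.
    + move=> w _; rewrite lee_fin /S !mulr_sumr.
      apply: le_trans (powR_jensen _ z2' _ _) _ => //.
        by move=> i _; rewrite sqr_ge0.
      rewrite sumr_const card_ord -[(_ *+ n)%R]mulr_natl mulfV ?gt_eqF// powR1 mul1r.
      rewrite ler_sum// => i _; rewrite -powR_mulrn// -powRrM.
      by rewrite mulrCA mulfV// mulr1.
  - by move=> u _; exact: powR_ge0.
  - exact: measurable_powR.
  - by move=> u v u0 uv; rewrite ge0_ler_powR ?nnegrE// ?(le_trans u0 uv)// (le_trans _ zeta1).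
have z2' : (0 < zeta / 2 <= 1)%R.
  by rewrite divr_gt0 ?(lt_le_trans _ zeta1)//= ler_pdivrMr// mul1r ltW// ltNge.
apply: le_trans (integral_powR_le PP z2' S0 mS) _.
apply: gt0_ler_poweR.
- by rewrite ltW//; case/andP: z2'.
- by rewrite in_itv/= leey andbT; apply: integral_ge0 => w _; rewrite lee_fin.
- by rewrite in_itv/= leey andbT; apply: integral_ge0 => w _; rewrite lee_fin sqr_ge0.
apply: (avg_int (fun u => u ^+ 2)%R) => //.
- by move=> u _; rewrite sqr_ge0.
- by move=> u v u0 uv; rewrite lerXn2r ?nnegrE// (le_trans u0 uv).
Qed.

End doubled_moment.

(** * The number of levels and the nets *)

Section rate.
Context {R : realType}.
Implicit Types (beta x : R).

Lemma geometric_sumE x J :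
  (x - 1) * \sum_(j < J) x ^+ j.+1 = x ^+ J.+1 - x.
Proof.
elim: J => [|J ih]; first by rewrite big_ord0 expr1 mulr0 subrr.
by rewrite big_ord_recr/= mulrDr ih !exprS; ring.
Qed.

Lemma rate_gt0 beta n : (0 < n)%N -> 0 < rate beta n.
Proof.
move=> n0; have nR0 : 0 < n%:R :> R by rewrite ltr0n.
rewrite /rate; case: ifP => _; first exact: powR_gt0.
case: ifP => _; last exact: powR_gt0.
by rewrite mulr_gt0 ?powR_gt0// ln_gt0// ltr1n.
Qed.

Lemma natr_le_exp2 n : n%:R <= 2 ^+ n :> R.
Proof. by rewrite -natrX ler_nat ltnW// ltn_expl. Qed.

Lemma invr_le_powR_half n : (0 < n)%N -> n%:R^-1 <= n%:R `^ (- 2^-1) :> R.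
Proof.
move=> n0; rewrite -[leLHS]powR_inv1// ler_powR ?ler1n// lerN2.
by rewrite invf_le1 ?ler1n.
Qed.

(** The Dudley sum converges, and any J with 2^-J <= n^(-1/2) will do; J = n is
    one. *)
Lemma rate_levels_lt1 beta : beta < 1 -> exists2 C, 0 < C &
  forall n, (0 < n)%N -> exists J,
  n%:R `^ (- 2^-1) * \sum_(j < J) (2 `^ (beta - 1)) ^+ j.+1 + 2 ^- J
  <= C * rate beta n.
Proof.
move=> beta1; set x := 2 `^ (beta - 1).
have x0 : 0 < x by exact: powR_gt0.
have x1 : x < 1.
  rewrite -(powRr0 2) /x /powR; rewrite !pnatr_eq0/= ltr_expR mul0r.
  by rewrite nmulr_rlt0 ?subr_lt0// ln_gt0// ltr1n.
exists ((1 - x)^-1 + 1); first by rewrite addr_gt0// invr_gt0 subr_gt0.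
move=> n n0; exists n; rewrite /rate beta1 mulrDl mul1r lerD//; last first.
  apply: le_trans (invr_le_powR_half n0).
  by rewrite lef_pV2 ?posrE ?exprn_gt0 ?ltr0n// natr_le_exp2.
rewrite mulrC ler_wpM2r ?powR_ge0//.
rewrite -[leRHS]mul1r ler_pdivlMr ?subr_gt0//.
rewrite -[leLHS]opprK -mulrN opprB mulrC geometric_sumE opprB.
by have := exprn_gt0 n.+1 x0; lra.
Qed.

(** All terms of the Dudley sum are equal to 1, and J is about log n. *)
Lemma rate_levels_eq1 : exists2 C : R, 0 < C &
  forall n, (0 < n)%N -> exists J,
  n%:R `^ (- 2^-1) * \sum_(j < J) (2 `^ (1 - 1)) ^+ j.+1 + 2 ^- J
  <= C * rate (1 : R) n.
Proof.
have l2 : 0 < ln 2 :> R by rewrite ln_gt0// ltr1n.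
exists (3 / ln 2); first by rewrite divr_gt0.
move=> n n0; exists (trunc_log 2 n).+1; rewrite /rate ltxx eqxx subrr powRr0.
under eq_bigr do rewrite expr1n.
rewrite sumr_const card_ord.
have nR0 : 0 < n%:R :> R by rewrite ltr0n.
have /andP[tl1 tl2] := trunc_log_bounds (isT : (1 < 2)%N) n0.
set L := trunc_log 2 n in tl1 tl2 *.
have lnn : ln 2 <= ln (n.+1%:R) :> R.
  by rewrite ler_ln ?posrE ?ltr0n// ler_nat.
have lnL : L%:R * ln 2 <= ln (n.+1%:R) :> R.
  rewrite mulr_natl -lnXn// ler_ln ?posrE ?exprn_gt0 ?ltr0n//.
  by rewrite -natrX ler_nat (leq_trans tl1).
set h := n%:R `^ (- 2^-1); have h0 : 0 <= h by exact: powR_ge0.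
have e1 : 2 ^- L.+1 <= h.
  apply: le_trans (invr_le_powR_half n0).
  by rewrite lef_pV2 ?posrE ?exprn_gt0 ?ltr0n// -natrX ler_nat ltnW.
apply: (@le_trans _ _ (h * (L%:R + 2))).
  by rewrite -natr1; lra.
rewrite mulrCA ler_wpM2l// mulrAC ler_pdivlMr//; lra.
Qed.

(** The Dudley sum is of the order of its last term 2^((beta - 1) J), and the
    least J such that 2^(beta J) >= sqrt n balances it with 2^-J. *)
Lemma rate_levels_gt1 beta : 1 < beta -> exists2 C, 0 < C &
  forall n, (0 < n)%N -> exists J,
  n%:R `^ (- 2^-1) * \sum_(j < J) (2 `^ (beta - 1)) ^+ j.+1 + 2 ^- J
  <= C * rate beta n.
Proof.
move=> beta1; have beta0 : 0 < beta by rewrite (lt_trans _ beta1).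
set x := 2 `^ (beta - 1).
have x1 : 1 < x.
  rewrite -(powRr0 2) /x /powR; rewrite !pnatr_eq0/= ltr_expR mul0r.
  by rewrite mulr_gt0 ?subr_gt0// ln_gt0// ltr1n.
have x0 : 0 < x by rewrite (lt_trans _ x1).
exists (x ^+ 2 / (x - 1) + 1).
  by rewrite addr_gt0// divr_gt0 ?exprn_gt0// subr_gt0.
move=> n n0; have nR0 : 0 < n%:R :> R by rewrite ltr0n.
rewrite /rate ltNge (ltW beta1)/= gt_eqF//.
set e := - (2 * beta)^-1.
have exJ : exists J, n%:R <= (2 ^+ J) `^ (2 * beta) :> R.
  exists n; apply: le_trans (natr_le_exp2 n) _.
  by rewrite le1r_powR ?exprn_ege1 ?ler1n//; lra.
have [J hJ minJ] := ex_minnP exJ.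
exists J; rewrite mulrDl mul1r lerD//; last first.
  have -> : 2 ^- J = ((2 ^+ J) `^ (2 * beta)) `^ e :> R.
    rewrite -powRrM /e mulrN mulfV ?mulf_neq0 ?gt_eqF//.
    by rewrite powR_inv1// exprn_ge0.
  rewrite /e !powRN lef_pV2 ?posrE ?powR_gt0 ?exprn_gt0//.
  by rewrite ge0_ler_powR ?nnegrE ?powR_ge0 ?invr_ge0// mulr_ge0// ltW.
case: J hJ minJ => [_ _|J _ minJ].
  by rewrite big_ord0 mulr0 mulr_ge0 ?powR_ge0// divr_ge0 ?sqr_ge0// subr_ge0 ltW.
have hJ : (2 ^+ J) `^ (2 * beta) <= n%:R :> R.
  by rewrite leNgt; apply/negP => /ltW/minJ; rewrite ltnn.
have xJ : x ^+ J <= n%:R `^ (2^-1 + e).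
  have -> : x ^+ J = ((2 ^+ J) `^ (2 * beta)) `^ (2^-1 + e).
    rewrite -powRrM -powR_mulrn ?(ltW x0)// /x -powRrM -(powR_mulrn J (ler0n R 2)).
    rewrite -powRrM; congr (_ `^ _); rewrite /e; field.
    by rewrite gt_eqF.
  rewrite ge0_ler_powR ?nnegrE ?powR_ge0// /e.
  rewrite subr_ge0 lef_pV2 ?posrE//; lra.
have S_le : \sum_(j < J.+1) x ^+ j.+1 <= x ^+ 2 / (x - 1) * x ^+ J.
  rewrite mulrAC ler_pdivlMr ?subr_gt0// mulrC geometric_sumE -exprD addSn add1n.
  by rewrite lerBlDr lerDl ltW.
apply: le_trans (ler_wpM2l (powR_ge0 _ _) S_le) _.
rewrite mulrCA ler_wpM2l ?divr_ge0 ?sqr_ge0 ?subr_ge0 ?(ltW x1)//.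
apply: le_trans (ler_wpM2l (powR_ge0 _ _) xJ) _.
rewrite -powRD ?(gt_eqF nR0) ?implybT//.
by rewrite addrA addNr add0r.
Qed.

Lemma rate_levels beta : exists2 C, 0 < C &
  forall n, (0 < n)%N -> exists J,
  n%:R `^ (- 2^-1) * \sum_(j < J) (2 `^ (beta - 1)) ^+ j.+1 + 2 ^- J
  <= C * rate beta n.
Proof.
have [b1|b1|->] := ltgtP beta 1; last exact: rate_levels_eq1.
- exact: rate_levels_lt1.
- exact: rate_levels_gt1.
Qed.

End rate.

Section nets.
Context {R : realType} {Q : Type}.

(** The covering number is finite, and then attained as an infimum of natural
    numbers. *)
Lemma cover_of_entropy (A : set Q) (b : Q -> Q -> R) (r e : R) : 0 <= e ->
  (sqrte (lne (covering_number A b r)) <= e%:E)%E ->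
  exists k (q : 'I_k -> Q), A `<=` \bigcup_j cball b (q j) r /\
    k%:R <= expR (e ^+ 2).
Proof.
move=> e0; rewrite /covering_number; set S := [set k | _].
have [->|/set0P[k0 Sk0]] := eqVneq S set0.
  by rewrite image_set0 ereal_inf0.
have exS : exists k, `[< S k >] by exists k0; exact/asboolP.
have [k /asboolP Sk mink] := ex_minnP exS.
have -> : ereal_inf [set (k%:R)%:E | k in S] = (k%:R)%:E :> \bar R.
  apply/eqP; rewrite eq_le; apply/andP; split.
    by apply: ereal_inf_lbound; exists k.
  apply: le_ereal_inf_tmp => _ [i Si <-]; rewrite lee_fin ler_nat.
  by apply: mink; exact/asboolP.
move=> h; have [q hq] := Sk; exists k, q; split => //.
case: k Sk mink h q hq => [|k] _ _ h _ _; first by rewrite expR_ge0.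
have k1 : 1 <= k.+1%:R :> R by rewrite ler1n.
move: h; rewrite lne_EFin ?ltr0n//= lee_fin => h.
rewrite -[leLHS]lnK ?posrE ?ltr0n// ler_expR -(sqr_sqrtr (ln_ge0 k1)).
by rewrite lerXn2r ?nnegrE// sqrtr_ge0.
Qed.

(** The constant kappa is such that the entropy bound at radius kappa E 2^-j is
    2^(beta j) / 2. At j = 0 this gives ln N <= 1/4 < ln 2: one ball covers A, and
    doubling its radius recentres it at m. Hence the factor 2 in the radii, and a
    net of level 0 reduced to m. *)
Lemma nets_of_entropy (b : Q -> Q -> R) (A : set Q) m (E beta ce kappa : R) :
  0 < beta -> 0 < ce -> pseudometric b -> A m -> 0 < E ->
  kappa = (2 * ce) `^ beta^-1 ->
  (forall r, 0 < r ->
    (sqrte (lne (covering_number A b r)) <= (ce * (E `^ beta / r `^ beta))%:E)%E) ->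
  exists N (net : forall j, 'I_(N j) -> Q),
  [/\ forall k, net 0 k = m,
      forall j, (N j.+1 * N j)%:R <= expR ((2 `^ (beta * j.+1%:R)) ^+ 2) &
      forall q, A q -> forall j, exists k, b (net j k) q <= 2 * kappa * E * 2 ^- j].
Proof.
move=> beta0 ce0 [b0 bq bC btri] Am E0 kappaE entropy.
have kappa0 : 0 < kappa by rewrite kappaE powR_gt0 ?mulr_gt0.
have kappab : kappa `^ beta = 2 * ce.
  by rewrite kappaE -powRrM mulVf ?gt_eqF// powRr1// mulr_ge0// ltW.
pose r (j : nat) := kappa * E * 2 ^- j.
have i20 j : 0 < 2 ^- j :> R by rewrite invr_gt0 exprn_gt0.
have r0 j : 0 < r j by rewrite !mulr_gt0.
have two_pow j : (2 ^- j) `^ beta = (2 `^ (beta * j%:R))^-1 :> R.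
  rewrite -powR_invn// -powRrM -powRN; congr (_ `^ _); ring.
have entE j : ce * (E `^ beta / (r j) `^ beta) = 2 `^ (beta * j%:R) / 2.
  rewrite /r !powRM ?mulr_ge0 ?(ltW kappa0) ?(ltW E0) ?(ltW (i20 j))//.
  rewrite kappab two_pow; field.
  by rewrite !gt_eqF ?powR_gt0.
have cover j : exists kq : {k & 'I_k -> Q},
    A `<=` \bigcup_i cball b (projT2 kq i) (r j) /\
    (projT1 kq)%:R <= expR ((2 `^ (beta * j%:R) / 2) ^+ 2).
  have [] := @cover_of_entropy A b (r j) (2 `^ (beta * j%:R) / 2).
  - by rewrite divr_ge0// powR_ge0.
  - by rewrite -entE; exact: entropy.
  by move=> k [q [h1 h2]]; exists (existT _ k q).
have /choice[kq hkq] := cover.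
pose nets (j : nat) : {k & 'I_k -> Q} :=
  if j is _.+1 then kq j else existT _ 1%N (fun=> m).
exists (fun j => projT1 (nets j)), (fun j => projT2 (nets j)).
have sizeS j : (projT1 (kq j.+1))%:R <= expR ((2 `^ (beta * j.+1%:R)) ^+ 2 / 4).
  have [_] := hkq j.+1; rewrite exprMn => /le_trans; apply.
  by rewrite ler_expR; lra.
have size0 j : (projT1 (nets j))%:R <= expR ((2 `^ (beta * j%:R)) ^+ 2 / 4).
  case: j => [|j] /=; last exact: sizeS.
  by rewrite -[leLHS]expR0 ler_expR divr_ge0 ?sqr_ge0.
have mono j : (2 `^ (beta * j%:R)) ^+ 2 <= (2 `^ (beta * j.+1%:R)) ^+ 2 :> R.
  rewrite lerXn2r ?nnegrE ?powR_ge0// ler_powR ?ler1n//.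
  by rewrite ler_wpM2l ?(ltW beta0)// ler_nat.
split => //.
- move=> j; rewrite natrM.
  apply: le_trans (ler_pM _ _ (size0 j.+1) (size0 j)) _ => //.
  rewrite -expRD ler_expR; have := mono j.
  have := sqr_ge0 (2 `^ (beta * j.+1%:R) : R); lra.
- move=> q Aq [|j] /=; last first.
    have [/(_ _ Aq)[k _ hk] _] := hkq j.+1; exists k.
    apply: le_trans hk _; rewrite /= -/(r j.+1); have := r0 j.+1; rewrite /r; lra.
  have [hc h1] := hkq 0%N.
  have : (projT1 (kq 0%N) < 2)%N.
    rewrite -(ltr_nat R); apply: le_lt_trans h1 _.
    rewrite mulr0 powRr0 div1r exprVn.
    have := expR_ge1Dx (- (2 ^+ 2)^-1 : R); have := expRxMexpNx_1 ((2 ^+ 2)^-1 : R).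
    set u := expR _; set v := expR _ => uv v1; rewrite ltNge; apply/negP => u2.
    have : 2 * (3 / 4) <= u * v by apply: ler_pM => //; lra.
    by rewrite uv; lra.
  move: hc; case: (kq 0%N) => -[|[|k]] //= c hc _.
    by have [[]] := hc _ Am.
  have [i _ hi] := hc _ Aq; have [i' _ hi'] := hc _ Am.
  exists ord0; apply: le_trans (btri _ (c i) _) _; rewrite [b m _]bC.
  move: hi hi'; rewrite (ord1 i) (ord1 i') /cball /r /= => hi hi'.
  by move: hi hi'; rewrite expr0 invr1; lra.
Qed.

End nets.

(** * The envelope of the symmetrized process *)

Section envelope.
Context {d' : measure_display} {V : measurableType d'} {R : realType} {Q : Type}.
Context (c : V -> Q -> R) (a : V * V -> R) (b : Q -> Q -> R).

Definition increment (z : V * V) (q : Q) : R := c z.2 q - c z.1 q.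

Definition quad_mean n (k : nat) (z : n.-tuple (V * V)%type) : R :=
  n%:R^-1 * \sum_i sym_quad a (tnth z i) ^+ k.

(** A measurable bound for the process indexed by the ball that the nets cover:
    the part between m and level J, and the truncation error. *)
Definition envelope (rho : nat -> R) N (net : forall j, 'I_(N j) -> Q) J n
    (z : n.-tuple (V * V)%type) : R :=
  chain b rho net J (fun i => increment (tnth z i)) + rho J * quad_mean 1 z.

Context (a0 : forall y z, 0 <= a (y, z)).

Lemma sym_quad_ge0 z : 0 <= sym_quad a z.
Proof. by case: z => y z; rewrite /sym_quad le_min !a0. Qed.

Lemma quad_mean_ge0 n k (z : n.-tuple (V * V)%type) : 0 <= quad_mean k z.
Proof.
rewrite mulr_ge0 ?invr_ge0// sumr_ge0// => i _.
by rewrite exprn_ge0 ?sym_quad_ge0.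
Qed.

Lemma envelope_ge0 rho N (net : forall j, 'I_(N j) -> Q) J n
    (z : n.-tuple (V * V)%type) : (forall j, 0 <= rho j) ->
  0 <= envelope rho net J z.
Proof.
by move=> rho0; rewrite addr_ge0 ?chain_ge0// mulr_ge0 ?quad_mean_ge0.
Qed.

Lemma increment_flip s z q : increment (flip s z) q = (-1) ^+ s * increment z q.
Proof. by case: s; rewrite /increment /flip/= ?expr1 ?expr0; ring. Qed.

(** The two orders of p, q give the absolute value, and the two orders of the
    data give each argument of the minimum. *)
Lemma increment_lipschitz z p q : pseudometric b ->
  (forall p q y z, c y q - c z q - c y p + c z p <= a (y, z) * b q p) ->
  `|increment z p - increment z q| <= sym_quad a z * b p q.
Proof.
move=> [b0 _ bC _] quad; have b0' := b0 p q.
have h1 := quad p q z.2 z.1; have h2 := quad q p z.2 z.1.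
have h3 := quad p q z.1 z.2; have h4 := quad q p z.1 z.2.
have ez : a (z.1, z.2) = a z by case: (z).
rewrite bC in h1 h3; rewrite ez in h3 h4.
by rewrite /increment /sym_quad /Num.min; case: ifP => _; rewrite ler_norml; apply/andP; split; lra.
Qed.

Lemma measurable_bigmax d (T : measurableType d) (I : Type) (r : seq I)
    (f : I -> T -> R) : (forall i, measurable_fun setT (f i)) ->
  measurable_fun setT (fun w => \big[Num.max/0]_(i <- r) f i w).
Proof.
move=> mf; elim: r => [|i r ih].
  by under eq_fun do rewrite big_nil; exact: measurable_cst.
by under eq_fun do rewrite big_cons; exact: measurable_maxr.
Qed.

Lemma measurable_quad_mean n k : measurable_fun setT a ->
  measurable_fun setT (@quad_mean n k).
Proof.
move=> ma; apply: measurable_funM => //; apply: measurable_sum => i.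
apply: measurable_funX; apply: (measurableT_comp (measurable_sym_quad ma)).
exact: measurable_tnth.
Qed.

Lemma measurable_increment q : (forall q, measurable_fun setT (c ^~ q)) ->
  measurable_fun setT (increment ^~ q).
Proof. by move=> mc; apply: measurable_funB; apply: (measurableT_comp (mc q)). Qed.

Lemma measurable_envelope rho N (net : forall j, 'I_(N j) -> Q) J n :
  (forall q, measurable_fun setT (c ^~ q)) -> measurable_fun setT a ->
  measurable_fun setT (@envelope rho N net J n).
Proof.
move=> mc ma; apply: measurable_funD; last first.
  by apply: measurable_funM => //; exact: measurable_quad_mean.
apply: measurable_sum => j; apply: measurable_bigmax => k.
apply: measurableT_comp => //; apply: measurable_funM => //.
apply: measurable_sum => i; rewrite /link.
case: (_ <= _); last exact: measurable_cst.
by apply: measurable_funB; apply: (measurableT_comp (measurable_increment _ mc));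
  exact: measurable_tnth.
Qed.

(** The Cauchy-Schwarz inequality, as Jensen's inequality for the square. *)
Lemma quad_mean1_le n (z : n.-tuple (V * V)%type) : (0 < n)%N ->
  quad_mean 1 z <= Num.sqrt (quad_mean 2 z).
Proof.
move=> n0; rewrite -[leLHS]ger0_norm ?quad_mean_ge0// -sqrtr_sqr.
apply: ler_wsqrtr.
have W1 : \sum_(i < n) (n%:R^-1) = 1 :> R.
  by rewrite sumr_const card_ord -[LHS]mulr_natr mulVf// pnatr_eq0 -lt0n.
have := @powR_jensen R 'I_n (index_enum _) xpredT
  (fun=> n%:R^-1) (fun i => sym_quad a (tnth z i)) 2.
rewrite -!mulr_sumr W1 powR1 mul1r.
have q1E : n%:R^-1 * \sum_(i < n) sym_quad a (tnth z i) = quad_mean 1 z by [].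
rewrite q1E powR_mulrn ?quad_mean_ge0// => h.
apply: le_trans (h _ _ _) _ => //; first by rewrite ler1n.
  by move=> i _; exact: sym_quad_ge0.
rewrite le_eqVlt; apply/orP; left; apply/eqP; congr (_ * _).
by apply: eq_bigr => i _; rewrite powR_mulrn ?sym_quad_ge0.
Qed.

End envelope.

(** Exchanging observations with their ghosts multiplies the increments by signs
    and leaves [sym_quad] alone, so [chain_moment] bounds the part between m and
    level J; the truncation error is at most rho J times the root of the
    quadratic mean. *)
Lemma envelope_moment (R : realType) (zeta : R) : 1 <= zeta ->
  exists2 C, 0 < C & forall (d' : measure_display) (V : measurableType d')
    (Q : Type) (c : V -> Q -> R) (a : V * V -> R) (b : Q -> Q -> R)
    (rho lam : nat -> R) N (net : forall j, 'I_(N j) -> Q) J n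
    (z : n.-tuple (V * V)%type),
  (0 < n)%N -> (forall j, 0 <= rho j) -> (forall j, 1 <= lam j) ->
  (forall j, (N j.+1 * N j)%:R <= expR (lam j ^+ 2)) ->
  (forall y z, 0 <= a (y, z)) -> pseudometric b ->
  (forall p q y z, c y q - c z q - c y p + c z p <= a (y, z) * b q p) ->
  avg (fun s : signs n => envelope c a b rho net J (flips s z) `^ zeta) <=
  C * (n%:R `^ (- 2^-1) * (\sum_(j < J) 3 * rho j.+1 * lam j) + rho J) `^ zeta *
  quad_mean a 2 z `^ (zeta / 2).
Proof.
move=> zeta1; have zeta0 : 0 <= zeta by rewrite (le_trans _ zeta1).
have [C C0 hC] := @chain_moment R zeta zeta1.
exists (2 `^ zeta * (C + 1)); first by rewrite mulr_gt0 ?powR_gt0// addr_gt0.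
move=> d' V Q c a b rho lam N net J n z n0 rho0 lam1 hN a0 pb quad.
set h := n%:R `^ (- 2^-1) * _; set S := Num.sqrt (quad_mean a 2 z).
have h0 : 0 <= h.
  rewrite mulr_ge0 ?powR_ge0// sumr_ge0// => j _.
  by rewrite !mulr_ge0// (le_trans ler01).
have S0 : 0 <= S by exact: sqrtr_ge0.
have -> : quad_mean a 2 z `^ (zeta / 2) = S `^ zeta.
  rewrite /S -powR12_sqrt; last exact: quad_mean_ge0.
  by rewrite -powRrM; congr (_ `^ _); rewrite mulrC.
have flipE (s : signs n) : envelope c a b rho net J (flips s z) =
    chain b rho net J (fun i q => (-1) ^+ s i * increment c (tnth z i) q) +
    rho J * quad_mean a 1 z.
  rewrite /envelope; congr (chain _ _ _ _ _ + _ * _).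
    apply/funext => i; apply/funext => q.
    by rewrite tnth_mktuple increment_flip.
  congr (_ * _); apply: eq_bigr => i _.
  by rewrite tnth_mktuple sym_quad_flip.
apply: (@le_trans _ _ (avg (fun s : signs n => 2 `^ zeta *
  (chain b rho net J (fun i q => (-1) ^+ s i * increment c (tnth z i) q) `^ zeta +
   (rho J * S) `^ zeta)))).
  apply: avg_le => s; rewrite flipE.
  apply: le_trans (powRD_le zeta0 _ _) _.
  - exact: chain_ge0.
  - by rewrite mulr_ge0 ?quad_mean_ge0.
  rewrite ler_wpM2l ?powR_ge0// lerD2l; apply: ge0_ler_powR => //.
  - by rewrite nnegrE mulr_ge0 ?quad_mean_ge0.
  - by rewrite nnegrE mulr_ge0.
  - by apply: ler_wpM2l => //; exact: quad_mean1_le.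
rewrite avgZ avgD avg_cst ?signs_gt0// -!mulrA ler_wpM2l ?powR_ge0//.
rewrite mulrDl mul1r -powRM ?addr_ge0//.
have chainC := hC Q b rho lam N net J n (fun i => increment c (tnth z i))
  (fun i => sym_quad a (tnth z i)) S n0 rho0 lam1
  (fun i p q => increment_lipschitz (tnth z i) p q pb quad)
  (fun i => sym_quad_ge0 a0 _) S0 _ hN.
apply: lerD.
  apply: le_trans (chainC _) _.
    by rewrite /S sqr_sqrtr ?quad_mean_ge0.
  rewrite ler_pM2l//; apply: ge0_ler_powR => //.
  - by rewrite nnegrE mulr_ge0.
  - by rewrite nnegrE mulr_ge0 ?addr_ge0.
  - by rewrite -/h mulrC; apply: ler_wpM2r => //; rewrite lerDl.
apply: ge0_ler_powR => //.
- by rewrite nnegrE mulr_ge0.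
- by rewrite nnegrE mulr_ge0 ?addr_ge0.
- by apply: ler_wpM2r => //; rewrite lerDr.
Qed.

(** * The ghost sample mean *)

Section ghost_sample.
Context {d d' : measure_display} {T : measurableType d} {V : measurableType d'}
  {R : realType} (P : probability T R).
Local Open Scope ereal_scope.

Lemma identically_distributed_integral (X Y : {RV P >-> V}) (g : V -> R) :
  identically_distributed X Y -> measurable_fun setT g ->
  \int[P]_w `|(g (Y w))%:E| < +oo ->
  P.-integrable setT (EFin \o (g \o X)) /\
  \int[P]_w (g (X w))%:E = \int[P]_w (g (Y w))%:E.
Proof.
move=> XY mg gY.
have lawE (f : V -> \bar R) :
    \int[distribution P X]_y f y = \int[distribution P Y]_y f y.
  by apply: eq_measure_integral => A mA _; exact: XY.
have mEg : measurable_fun setT (EFin \o g) by exact/measurable_EFinP.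
have intY : P.-integrable setT (EFin \o (g \o Y)).
  by apply/integrableP; split => //; apply/measurable_EFinP; exact: measurableT_comp.
have intX : P.-integrable setT (EFin \o (g \o X)).
  apply/integrableP; split.
    by apply/measurable_EFinP; exact: measurableT_comp.
  have := @ge0_integral_distribution _ _ _ _ _ P X (fun y => `|(g y)%:E|).
  rewrite /comp => <- //; last exact: measurableT_comp.
  rewrite lawE ge0_integral_distribution//; exact: measurableT_comp.
split => //.
have := @integral_distribution _ _ _ _ _ P X (EFin \o g) mEg intX.
rewrite lawE (@integral_distribution _ _ _ _ _ P Y (EFin \o g) mEg intY).
by rewrite /comp => ->.
Qed.

Lemma integral_le_ge0 (f g : T -> R) : P.-integrable setT (EFin \o f) ->
  measurable_fun setT g -> (forall w, 0 <= g w)%R -> (forall w, f w <= g w)%R ->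
  \int[P]_w (f w)%:E <= \int[P]_w (g w)%:E.
Proof.
move=> intf mg g0 fg.
have [->|/negbTE goo] := eqVneq (\int[P]_w (g w)%:E) +oo; first exact: leey.
apply: le_integral => //; last by move=> w _; rewrite lee_fin.
apply/integrableP; split; first exact/measurable_EFinP.
rewrite ltey; under eq_integral => w _ do rewrite /= ger0_norm//.
by rewrite goo.
Qed.

Context {Q : Type} (c : V -> Q -> R).
Context (mc : forall q, measurable_fun setT (c ^~ q)).

(** Integrating out the ghost sample recovers the centred process at the observed
    sample w. *)
Lemma integral_increments n (Y : {RV P >-> V}) (X : 'I_n -> {RV P >-> V}) m q w :
  (0 < n)%N -> (forall i, identically_distributed (X i) Y) ->
  (forall q, 'E_P[fun w => `|c (Y w) q|%R] < +oo) ->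
  let G w' := (n%:R^-1 * \sum_i (increment c (X i w, X i w') q -
                                 increment c (X i w, X i w') m))%R in
  P.-integrable setT (EFin \o G) /\
  \int[P]_w' (G w')%:E = (fine (risk c Y q) - fine (risk c Y m) -
    (empirical_risk c X w q - empirical_risk c X w m))%:E.
Proof.
move=> n0 XY finc G.
have abs_fin p : \int[P]_w `|(c (Y w) p)%:E| < +oo.
  by have := finc p; rewrite unlock.
pose k := (- (empirical_risk c X w q - empirical_risk c X w m))%R.
pose g i w' := (n%:R^-1 * (c (X i w') q - c (X i w') m))%R.
have intc i p : P.-integrable setT (EFin \o (fun w' => c (X i w') p)).
  by have [] := identically_distributed_integral (XY i) (mc p) (abs_fin p).
have intcE i p : \int[P]_w' (c (X i w') p)%:E = risk c Y p.
  have [_ ->] := identically_distributed_integral (XY i) (mc p) (abs_fin p).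
  by rewrite /risk unlock.
have risk_fin p : risk c Y p \is a fin_num.
  by rewrite -(intcE (Ordinal n0) p); exact: (integrable_fin_num measurableT (intc _ p)).
have intB i : P.-integrable setT (fun w' => (c (X i w') q)%:E - (c (X i w') m)%:E).
  exact: (integrableB measurableT (intc i q) (intc i m)).
have intg i : P.-integrable setT (EFin \o g i).
  apply: eq_integrable (integrableZl measurableT n%:R^-1 (intB i)) => //.
have intgE i : \int[P]_w' (g i w')%:E =
    (n%:R^-1 * (fine (risk c Y q) - fine (risk c Y m)))%:E.
  transitivity (\int[P]_w' (n%:R^-1%:E * ((c (X i w') q)%:E - (c (X i w') m)%:E))).
    by [].
  rewrite integralZl// integralB_EFin// !intcE.
  by rewrite EFinM EFinB !fineK.
have GE w' : (G w')%:E = \sum_i (g i w')%:E + k%:E.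
  rewrite sumEFin -EFinD; congr EFin; rewrite /G /k /g /increment/=.
  rewrite /empirical_risk -mulr_sumr -mulrBr -mulrN -mulrDr; congr (_ * _)%R.
  rewrite -sumrB -sumrN -big_split/=; apply: eq_bigr => i _; ring.
have intk : P.-integrable setT (EFin \o cst k) by exact: finite_measure_integrable_cst.
have intS : P.-integrable setT (fun w' => \sum_i (g i w')%:E).
  by apply: integrable_sum => // i _; exact: intg.
split.
  have -> : EFin \o G = (fun w' => \sum_i (g i w')%:E) \+ (EFin \o cst k).
    by apply/funext => w' /=; rewrite GE.
  exact: integrableD.
under eq_integral => w' _ do rewrite GE.
rewrite integralD//.
rewrite integral_sum//.
under eq_bigr do rewrite intgE.
rewrite sumEFin integral_cst//= probability_setT mule1 -EFinD; congr EFin.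
rewrite /k; congr (_ - _)%R.
rewrite sumr_const card_ord -[LHS]mulr_natl mulrA mulfV ?mul1r//.
by rewrite pnatr_eq0 -lt0n.
Qed.

End ghost_sample.

(** * The deviation bound on a ball *)

(** By [integral_doubled_flips] the integral of K^zeta does not depend on the
    exchange pattern, so it is the integral of its average over the patterns. *)
Lemma symmetrized_moment (R : realType) (d d' : measure_display)
    (T : measurableType d) (V : measurableType d') (P : probability T R)
    n (X : 'I_n -> {RV P >-> V}) (K : n.-tuple (V * V)%type -> R)
    (B : R) (S : n.-tuple (V * V)%type -> R) (zeta : R) :
  mutually_independent X -> measurable_fun setT K -> (forall z, 0 <= K z) ->
  measurable_fun setT S -> (forall z, 0 <= S z) -> 0 <= B ->
  (forall z, avg (fun s : signs n => K (flips s z) `^ zeta) <= B * S z) ->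
  (\int[P \x P]_w (K (doubled X w) `^ zeta)%:E <=
   B%:E * \int[P \x P]_w (S (doubled X w))%:E)%E.
Proof.
move=> indep mK K0 mS S0 B0 h.
have mKz : measurable_fun setT (fun z => K z `^ zeta) by exact: measurable_fun_powR.
have mdX := measurable_doubled X.
have mKs (s : signs n) : measurable_fun setT
    (fun w => (K (flips s (doubled X w)) `^ zeta)%:E).
  apply/measurable_EFinP; apply: (measurableT_comp mKz).
  by apply: measurableT_comp => //; exact: measurable_flips.
rewrite -ge0_integralZl_EFin//; last 2 first.
- by move=> w _; rewrite lee_fin.
- by apply/measurable_EFinP; exact: measurableT_comp.
have -> : (\int[P \x P]_w (K (doubled X w) `^ zeta)%:E =
    \int[P \x P]_w (avg (fun s : signs n => K (flips s (doubled X w)) `^ zeta))%:E)%E.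
  under [RHS]eq_integral => w _ do rewrite EFinM -sumEFin.
  rewrite ge0_integralZl_EFin ?invr_ge0//; last 2 first.
  - by move=> w _; apply: sume_ge0 => s _; rewrite lee_fin powR_ge0.
  - exact: emeasurable_sum.
  rewrite ge0_integral_sum//; last by move=> s w _; rewrite lee_fin powR_ge0.
  rewrite (eq_bigr (fun=> \int[P \x P]_w (K (doubled X w) `^ zeta)%:E)%E); last first.
    move=> s _; apply: (integral_doubled_flips s (f := fun z => (K z `^ zeta)%:E)) => //.
    - exact/measurable_EFinP.
    - by move=> z; rewrite lee_fin powR_ge0.
  rewrite -big_enum/= big_const_seq count_predT -cardE.
  rewrite -(card_ord #|signs n|) -big_const sum_cst_ord; last first.
    by apply: integral_ge0 => w _; rewrite lee_fin powR_ge0.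
  rewrite muleA -EFinM card_ord mulVf ?mul1e//.
  by rewrite pnatr_eq0 -lt0n signs_gt0.
apply: ge0_le_integral => //.
- by move=> w _; rewrite lee_fin avg_ge0// => s; rewrite powR_ge0.
- apply/measurable_EFinP; apply: measurable_funM => //.
  by apply: measurable_sum => s; apply/measurable_EFinP; exact: mKs.
- apply/measurable_EFinP; apply: measurable_funM => //.
  exact: measurableT_comp.
- by move=> w _; rewrite lee_fin h.
Qed.

(** Where the process exceeds x, so does the mean over the ghost sample of the
    envelope, because the envelope dominates every symmetrized increment. By
    Jensen's inequality the ghost integral of envelope^zeta then exceeds x^zeta, and
    Markov's inequality applies to it; Tonelli's theorem and
    [symmetrized_moment] bound its mean. *)
Lemma shell_bound (R : realType) (alpha beta ce zeta : R) :
  0 < beta -> 0 < ce -> 1 <= zeta ->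
  exists2 C, 0 < C & forall (Q : Type)
    (dV : measure_display) (V : measurableType dV)
    (dT : measure_display) (T : measurableType dT) (P : probability T R)
    (Y Y' : {RV P >-> V}) (n : nat) (Ys : 'I_n -> {RV P >-> V})
    (c : V -> Q -> R) (l : Q -> Q -> R) (a : V * V -> R) (b : Q -> Q -> R)
    (m : Q) (delta x : R) (A : set T),
  (0 < n)%N ->
  (forall i, identically_distributed (Ys i) Y) ->
  mutually_independent Ys ->
  identically_distributed Y' Y -> independent2 Y' Y ->
  (forall q, measurable_fun setT (fun y => c y q)) ->
  (forall q, ('E_P[fun w => `|c (Y w) q|%R] < +oo)%E) ->
  measurable_fun setT a ->
  (forall y z, 0 <= a (y, z)) ->
  pseudometric b ->
  (forall p q y z, c y q - c z q - c y p + c z p <= a (y, z) * b q p) ->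
  (forall r, 0 < r -> (sqrte (lne (covering_number (cball l m delta) b r))
      <= (ce * (delta `^ alpha / r `^ beta))%:E)%E) ->
  l m m <= delta -> 0 < delta -> 0 < x -> measurable A ->
  (forall w, A w -> exists2 q, l m q <= delta &
     x <= fine (risk c Y q) - fine (risk c Y m) -
          (empirical_risk c Ys w q - empirical_risk c Ys w m)) ->
  (P A <= (C * (delta `^ (alpha / beta) * rate beta n / x) `^ zeta)%:E *
          moment_functional a Y' Y zeta)%E.
Proof.
move=> beta0 ce0 zeta1; have zeta0 : 0 < zeta by rewrite (lt_le_trans _ zeta1).
have [C1 C10 moment] := @envelope_moment R zeta zeta1.
have [Cr Cr0 levels] := @rate_levels R beta.
pose kappa := (2 * ce) `^ beta^-1.
have kappa0 : 0 < kappa by rewrite powR_gt0 ?mulr_gt0.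
pose c6 := 6 * kappa * Cr.
have c60 : 0 < c6 by rewrite !mulr_gt0.
exists (C1 * c6 `^ zeta); first by rewrite mulr_gt0 ?powR_gt0.
move=> Q dV V dT T P Y Y' n Ys c l a b m delta x A n0 idY indep idY' ind2 mc
  finc ma a0 pb quad entropy lmm delta0 x0 mA hA.
pose E := delta `^ (alpha / beta).
have E0 : 0 < E by exact: powR_gt0.
have Ebeta : E `^ beta = delta `^ alpha by rewrite -powRrM divfK ?gt_eqF.
have entropyE r : 0 < r -> (sqrte (lne (covering_number (cball l m delta) b r))
      <= (ce * (E `^ beta / r `^ beta))%:E)%E.
  by move=> r0; rewrite Ebeta; exact: entropy.
have [N [net [net0 netN netcov]]] :=
  @nets_of_entropy R Q b (cball l m delta) m E beta ce kappa beta0 ce0 pb lmm E0 erefl entropyE.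
have [J hJ] := levels n n0.
pose rho (j : nat) := 2 * kappa * E * 2 ^- j.
pose lam (j : nat) := 2 `^ (beta * j.+1%:R) : R.
have i20 j : 0 < 2 ^- j :> R by rewrite invr_gt0 exprn_gt0.
have rho0 j : 0 <= rho j by rewrite !mulr_ge0 ?(ltW kappa0) ?(ltW E0) ?(ltW (i20 j)).
have lam1 j : 1 <= lam j.
  by rewrite /lam -[leLHS](powRr0 2) ler_powR ?ler1n// mulr_ge0// ltW.
have rhoS j : rho j = 2 * rho j.+1.
  by rewrite /rho exprS; field; rewrite gt_eqF// exprn_gt0.
pose K := @envelope _ V R Q c a b rho N net J n.
pose h := n%:R `^ (- 2^-1) * (\sum_(j < J) 3 * rho j.+1 * lam j) + rho J.
have h0 : 0 <= h.
  apply: addr_ge0 => //; apply: mulr_ge0; first exact: powR_ge0.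
  apply: sumr_ge0 => j _.
  by rewrite (mulr_ge0 (mulr_ge0 _ (rho0 _)) (le_trans ler01 (lam1 _))).
(* The factor 6 is 3 * 2, from the links and from the radii 2 kappa E 2^-j. *)
have hle : h <= c6 * (E * rate beta n).
  apply: (@le_trans _ _ (6 * kappa * E * (n%:R `^ (- 2^-1) *
      \sum_(j < J) (2 `^ (beta - 1)) ^+ j.+1 + 2 ^- J))).
    rewrite mulrDr /h; apply: lerD; last first.
      rewrite /rho; apply: ler_wpM2r; first exact: ltW.
      by rewrite !ler_pM2r//; lra.
    rewrite mulrCA; apply: ler_wpM2l; first exact: powR_ge0.
    rewrite mulr_sumr; apply: ler_sum => j _; rewrite /rho /lam.
    have -> : (2 `^ (beta - 1)) ^+ j.+1 = 2 `^ (beta * j.+1%:R) * 2 ^- j.+1 :> R.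
      rewrite -powR_mulrn ?powR_ge0// -powRrM -powR_invn// -powRD.
        by congr (_ `^ _); ring.
      by rewrite pnatr_eq0/= implybT.
    by rewrite le_eqVlt; apply/orP; left; apply/eqP; ring.
  apply: (@le_trans _ _ (6 * kappa * E * (Cr * rate beta n))).
    by apply: ler_wpM2l => //; rewrite !mulr_ge0 ?(ltW kappa0) ?(ltW E0).
  by rewrite le_eqVlt; apply/orP; left; apply/eqP; rewrite /c6; ring.
have K0 z : 0 <= K z by exact: envelope_ge0.
have mK : measurable_fun setT K by exact: measurable_envelope.
have mdX := measurable_doubled Ys.
have mKzd : measurable_fun setT (fun w : T * T => (K (doubled Ys w) `^ zeta)%:E).
  by apply/measurable_EFinP/measurable_fun_powR; exact: measurableT_comp.
have pointwise w : A w ->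
    ((x `^ zeta)%:E <= \int[P]_w' (K (doubled Ys (w, w')) `^ zeta)%:E)%E.
  move=> Aw; have [q qB xq] := hA w Aw.
  have mKw : measurable_fun setT (fun w' => K (doubled Ys (w, w'))).
    apply: measurableT_comp => //; apply: measurableT_comp => //.
  apply: (@integral_powR_ge _ _ _ P (fun w' => K (doubled Ys (w, w')))) => //.
  have [intG GE] := @integral_increments _ _ _ _ _ P Q c mc n Y Ys m q w n0 idY finc.
  apply: (@le_trans _ _ (fine (risk c Y q) - fine (risk c Y m) -
          (empirical_risk c Ys w q - empirical_risk c Ys w m))%:E).
    by rewrite lee_fin.
  rewrite -GE; apply: integral_le_ge0 => // w'.
  have := @chain_dominates R Q b rho N net J n
    (fun i => increment c (tnth (doubled Ys (w, w')) i))
    (fun i => sym_quad a (tnth (doubled Ys (w, w')) i)) m q pb rhoS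
    (fun i p q => increment_lipschitz (tnth (doubled Ys (w, w')) i) p q pb quad)
    net0 (fun i => sym_quad_ge0 a0 _) (netcov q qB).
  under eq_bigr do rewrite tnth_mktuple/=.
  move/le_trans; apply; rewrite /K /envelope /quad_mean.
  by under [X in _ <= _ + _ * (_ * X)]eq_bigr do rewrite expr1.
have mKF : measurable_fun setT
    (fun w => \int[P]_w' (K (doubled Ys (w, w')) `^ zeta)%:E)%E.
  apply: (measurable_fun_fubini_tonelli_F (m2 := P)
    (fun w : T * T => (K (doubled Ys w) `^ zeta)%:E)) => // w.
  by rewrite lee_fin powR_ge0.
have markov_step : ((x `^ zeta)%:E * P A <=
    \int[P \x P]_w (K (doubled Ys w) `^ zeta)%:E)%E.
  rewrite fubini_tonelli1//; last by move=> w; rewrite lee_fin powR_ge0.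
  rewrite -[leLHS]integral_cst// /fubini_F.
  apply: (@le_trans _ _ (\int[P]_(w in A) (\int[P]_w' (K (doubled Ys (w, w')) `^ zeta)%:E))%E).
    apply: ge0_le_integral => //.
    - by move=> w _; rewrite /= lee_fin powR_ge0.
    - exact: measurable_funTS.
  apply: ge0_subset_integral => // w _.
  by apply: integral_ge0 => w' _; rewrite lee_fin powR_ge0.
have xz0 : 0 < x `^ zeta by rewrite powR_gt0.
have B0 : 0 <= C1 * h `^ zeta by rewrite mulr_ge0 ?powR_ge0// ltW.
have sym := @symmetrized_moment R _ _ T V P n Ys K (C1 * h `^ zeta)
  (fun z => quad_mean a 2 z `^ (zeta / 2)) zeta indep mK K0
  (measurable_fun_powR _ (@measurable_quad_mean _ V R a n 2 ma))
  (fun z => powR_ge0 _ _) B0 (fun z => moment _ V Q c a b rho lam N net J n z n0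
    rho0 lam1 netN a0 pb quad).
have dm := doubled_moment n0 idY idY' ind2 ma a0 zeta1.
have M0 : (0 <= moment_functional a Y' Y zeta)%E.
  apply: le_trans dm; apply: integral_ge0 => w _; rewrite lee_fin; exact: powR_ge0.
have : ((x `^ zeta)%:E * P A <= (C1 * h `^ zeta)%:E * moment_functional a Y' Y zeta)%E.
  apply: le_trans markov_step _; apply: le_trans sym _.
  by apply: lee_wpmul2l => //; rewrite lee_fin.
rewrite -lee_pdivlMl// => /le_trans; apply.
rewrite muleA -EFinM; apply: lee_wpmul2r => //; rewrite lee_fin.
have Er0 : 0 <= E * rate beta n by rewrite mulr_ge0 ?(ltW E0)// ltW// rate_gt0.
rewrite [(_ / x) `^ _]powRM ?invr_ge0// ?(ltW x0)//.
have -> : x^-1 `^ zeta = (x `^ zeta)^-1.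
  by rewrite -powR_inv1 ?(ltW x0)// powRAC powR_inv1// ltW.
rewrite mulrC mulrA; apply: ler_wpM2r; first by rewrite invr_ge0 ltW.
rewrite -mulrA -powRM// ?(ltW c60)//; apply: ler_wpM2l; first exact: ltW.
by rewrite ge0_ler_powR ?nnegrE// ?(ltW zeta0)// mulr_ge0// ltW.
Qed.

(** * Peeling *)

Lemma dyadic_shell (R : realType) (s y : R) : 0 < s -> s <= y ->
  exists k, 2 ^+ k * s <= y < 2 ^+ k.+1 * s.
Proof.
move=> s0 sy; have y0 : 0 <= y / s by rewrite divr_ge0 ?(ltW s0)// (le_trans (ltW s0)).
have ex : exists k, y < 2 ^+ k.+1 * s.
  exists (Num.truncn (y / s)); rewrite -ltr_pdivrMr//.
  apply: lt_le_trans (truncnS_gt _) _; exact: natr_le_exp2.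
have [k hk mink] := ex_minnP ex; exists k; rewrite hk andbT.
case: k hk mink => [|k] _ mink; first by rewrite expr0 mul1r.
by rewrite leNgt; apply/negP => /mink; rewrite ltnn.
Qed.

Lemma measure_geometric_union (d : measure_display) (T : measurableType d)
    (R : realType) (mu : {measure set T -> \bar R}) (X : set T)
    (A : nat -> set T) (u r : R) :
  measurable X -> (forall k, measurable (A k)) -> X `<=` \bigcup_k A k ->
  0 <= u -> 0 <= r < 1 -> (forall k, mu (A k) <= (u * r ^+ k)%:E)%E ->
  (mu X <= (u / (1 - r))%:E)%E.
Proof.
move=> mX mA XA u0 /andP[r0 r1] hA.
apply: le_trans (measure_sigma_subadditive mu mA mX XA) _.
apply: lime_le; first by apply: is_cvg_nneseries => k _ _; exact: measure_ge0.
apply: nearW => n.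
apply: (@le_trans _ _ (\sum_(0 <= k < n) (u * r ^+ k)%:E)%E).
  by apply: lee_sum => k _; exact: hA.
rewrite sumEFin lee_fin -mulr_sumr ler_wpM2l//.
rewrite -[leRHS]mul1r ler_pdivlMr ?subr_gt0//.
rewrite big_mkord mulrC -opprB mulNr -subrX1 opprB.
by rewrite lerBlDr lerDl exprn_ge0.
Qed.

Theorem theorem1 (R : realType) (alpha beta gamma ce cg zeta : R)
    (alpha_gt0 : 0 < alpha) (beta_gt0 : 0 < beta) (gamma_gt0 : 0 < gamma)
    (ce_gt0 : 0 < ce) (cg_gt0 : 0 < cg) (zeta_ge1 : 1 <= zeta)
    (alpha_beta_gamma : alpha / beta < gamma) :
  exists C : R, 0 < C /\
  forall (Q : Type)
    (dV : measure_display) (V : measurableType dV)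
    (dT : measure_display) (T : measurableType dT) (P : probability T R)
    (Y Y' : {RV P >-> V})
    (n : nat) (Ys : 'I_n -> {RV P >-> V})
    (c : V -> Q -> R) (l : Q -> Q -> R)
    (a : V * V -> R) (b : Q -> Q -> R)
    (m : Q) (mn : T -> Q),
  (* setting *)
  (0 < n)%N ->
  (forall i, identically_distributed (Ys i) Y) ->
  mutually_independent Ys ->
  identically_distributed Y' Y ->
  independent2 Y' Y ->
  (forall q, measurable_fun setT (fun y => c y q)) ->
  (forall p q, 0 <= l p q) ->
  (* existence *)
  (forall q, ('E_P[fun w => `|c (Y w) q|%R] < +oo)%E) ->
  m \in argmin (risk c Y) ->
  (forall w, mn w \in argmin (empirical_risk c Ys w)) ->
  measurable_fun setT (fun w => l m (mn w)) ->
  (* growth *)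
  (forall q, ((cg * l m q `^ gamma)%:E <= risk c Y q - risk c Y m)%E) ->
  (* weak quadruple *)
  measurable_fun setT a ->
  (forall y z, 0 <= a (y, z)) ->
  pseudometric b ->
  (forall p q y z, c y q - c z q - c y p + c z p <= a (y, z) * b q p) ->
  (* moment *)
  (moment_functional a Y' Y zeta < +oo)%E ->
  (* entropy *)
  (forall delta r : R, 0 < delta -> 0 < r ->
    (sqrte (lne (covering_number (cball l m delta) b r))
      <= (ce * (delta `^ alpha / r `^ beta))%:E)%E) ->
  forall t : R, 0 < t ->
    (P [set w | (t <= rate beta n `^ (- (gamma - alpha / beta)^-1)
                      * l m (mn w))%R]
     <= C%:E * moment_functional a Y' Y zeta
        * (t `^ (- (zeta * (gamma - alpha / beta))))%:E)%E.
Proof.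
have zeta0 : 0 < zeta by rewrite (lt_le_trans _ zeta_ge1).
have [C0 C00 shell] := @shell_bound R alpha beta ce zeta beta_gt0 ce_gt0 zeta_ge1.
set theta := gamma - alpha / beta.
have theta0 : 0 < theta by rewrite subr_gt0.
pose c0 := 2 `^ (alpha / beta) / cg.
have c00 : 0 < c0 by rewrite divr_gt0 ?powR_gt0.
pose r := (2 `^ (- theta)) `^ zeta.
have r0 : 0 < r by rewrite !powR_gt0.
have r1 : r < 1.
  rewrite /r -powRrM mulNr powRN invf_lt1 ?powR_gt0//.
  rewrite -[ltLHS](powRr0 2) /powR !pnatr_eq0/= ltr_expR mul0r.
  by rewrite !mulr_gt0// ln_gt0// ltr1n.
exists (C0 * c0 `^ zeta / (1 - r)); split.
  by rewrite divr_gt0 ?subr_gt0// mulr_gt0 ?powR_gt0.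
move=> Q dV V dT T P Y Y' n Ys c l a b m mn n0 idY indep idY' ind2 mc l0 finc
  _ mn_min mlmn growth ma a0 pb quad Mfin entropy t t0.
have risk_fin q : risk c Y q \is a fin_num.
  have /(_ _)[|intc _] := @identically_distributed_integral _ _ T V R P Y Y (c ^~ q)
    (fun A _ => erefl) (mc q).
    by have := finc q; rewrite unlock.
  by rewrite /risk unlock; exact: (integrable_fin_num measurableT intc).
have growthR q : cg * l m q `^ gamma <= fine (risk c Y q) - fine (risk c Y m).
  by rewrite -lee_fin EFinB !fineK//; exact: growth.
(* The growth condition at m itself puts m in all the balls. *)
have lmm : l m m = 0.
  apply: (@powR_eq0_eq0 _ _ gamma); apply/eqP; rewrite eq_le powR_ge0 andbT.
  by have := growthR m; rewrite subrr pmulr_rle0.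
set eta := rate beta n; have eta0 : 0 < eta by exact: rate_gt0.
have M0 : (0 <= moment_functional a Y' Y zeta)%E.
  rewrite /moment_functional; case: ifP => _; last exact: poweR_ge0.
  by apply: expectation_ge0 => w; exact: powR_ge0.
set s := t * eta `^ theta^-1; have s0 : 0 < s by rewrite mulr_gt0 ?powR_gt0.
pose A k := [set w | 2 ^+ k * s <= l m (mn w) < 2 ^+ k.+1 * s].
have mA k : measurable (A k).
  rewrite (_ : A k = (fun w => l m (mn w)) @^-1`
      `[2 ^+ k * s, 2 ^+ k.+1 * s[%classic); last first.
    by apply/seteqP; split=> w /=; rewrite in_itv.
  by rewrite -[X in measurable X]setTI; exact: mlmn.
(* The power of eta in s is chosen so that the bound for a shell is free of eta. *)
have shellE k : ((2 ^+ k.+1 * s) `^ (alpha / beta) * eta /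
    (cg * (2 ^+ k * s) `^ gamma)) `^ zeta =
    c0 `^ zeta * t `^ (- (zeta * theta)) * r ^+ k.
  set u := 2 ^+ k * s; have u0 : 0 < u by rewrite mulr_gt0 ?exprn_gt0.
  have -> : 2 ^+ k.+1 * s = 2 * u by rewrite /u exprS mulrA.
  have -> : (2 * u) `^ (alpha / beta) * eta / (cg * u `^ gamma) =
      c0 * (eta * u `^ (- theta)).
    rewrite powRM ?(ltW u0)// /theta opprB powRB ?(gt_eqF u0) ?implybT//.
    by rewrite /c0; field; rewrite !gt_eqF ?powR_gt0.
  have -> : eta * u `^ (- theta) = t `^ (- theta) * (2 `^ (- theta)) ^+ k.
    rewrite /u powRM ?exprn_ge0 ?(ltW s0)// /s powRM ?powR_ge0 ?(ltW t0)//.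
    rewrite -[(eta `^ _) `^ _]powRrM mulrN mulVf ?gt_eqF//.
    rewrite powR_inv1 ?(ltW eta0)// -powR_mulrn// powRAC powR_mulrn ?powR_ge0//.
    by field; rewrite gt_eqF.
  rewrite powRM ?(ltW c00) ?mulr_ge0 ?powR_ge0 ?exprn_ge0//.
  rewrite powRM ?powR_ge0 ?exprn_ge0 ?powR_ge0// -powRrM mulNr [theta * _]mulrC.
  rewrite /r -[(_ `^ zeta) ^+ k]powR_mulrn ?powR_ge0// powRAC powR_mulrn ?powR_ge0//.
  by rewrite mulrA.
have PA k : (P (A k) <= (C0 * (c0 `^ zeta * t `^ (- (zeta * theta)) * r ^+ k))%:E *
    moment_functional a Y' Y zeta)%E.
  have d0 : 0 < 2 ^+ k.+1 * s by rewrite mulr_gt0 ?exprn_gt0.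
  rewrite -shellE.
  apply: (shell Q dV V dT T P Y Y' n Ys c l a b m (2 ^+ k.+1 * s)
    (cg * (2 ^+ k * s) `^ gamma) (A k)) => //.
  - by move=> r' r'0; exact: entropy.
  - by rewrite lmm ltW.
  - by apply: mulr_gt0 => //; apply: powR_gt0; rewrite mulr_gt0 ?exprn_gt0.
  move=> w /= /andP[lw wl]; exists (mn w); first exact: ltW.
  have Fn : empirical_risk c Ys w (mn w) - empirical_risk c Ys w m <= 0.
    by rewrite subr_le0; have := mn_min w; rewrite inE; exact.
  apply: (@le_trans _ _ (fine (risk c Y (mn w)) - fine (risk c Y m))); last first.
    by rewrite lerDl oppr_ge0.
  apply: le_trans (growthR (mn w)).
  rewrite ler_pM2l//; apply: ge0_ler_powR lw => //.
  - exact: ltW.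
  - by rewrite nnegrE mulr_ge0 ?exprn_ge0 ?(ltW s0).
  - by rewrite nnegrE.
have mX : measurable [set w | (t <= eta `^ (- theta^-1) * l m (mn w))%R].
  rewrite (_ : [set w | _] = (fun w => eta `^ (- theta^-1) * l m (mn w)) @^-1`
      `[t, +oo[%classic); last first.
    by apply/seteqP; split=> w /=; rewrite in_itv/= andbT.
  rewrite -[X in measurable X]setTI.
  exact: (measurable_funM (measurable_cst _) mlmn).
set tz := t `^ (- (zeta * theta)) in PA *.
have tz0 : 0 <= tz by exact: powR_ge0.
have [M ME] : exists M, moment_functional a Y' Y zeta = M%:E.
  by exists (fine (moment_functional a Y' Y zeta)); rewrite fineK// ge0_fin_numE.
move: M0 PA; rewrite ME lee_fin => M0 PA.
have := @measure_geometric_union _ T R P _ A (C0 * (c0 `^ zeta * tz) * M) r mX mA.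
rewrite -!EFinM.
have -> : C0 * (c0 `^ zeta * tz) * M / (1 - r) =
  C0 * c0 `^ zeta / (1 - r) * M * tz by field; lra.
apply => //.
- move=> w /= tw.
  have sw : s <= l m (mn w).
    move: tw; rewrite powRN -ler_pdivrMl ?invr_gt0 ?powR_gt0// invrK.
    by rewrite /s mulrC.
  by have [k hk] := dyadic_shell s0 sw; exists k.
- by rewrite !mulr_ge0 ?powR_ge0 ?(ltW C00).
- by rewrite (ltW r0).
- move=> k; apply: le_trans (PA k) _; rewrite -EFinM lee_fin.
  by rewrite le_eqVlt; apply/orP; left; apply/eqP; ring.
Qed.
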